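(* Let $\pi:\mathcal C\to\mathbb C$ be a fragmented deformation of length $2$, with irreducible components $\mathcal C_1,\mathcal C_2$, of the primitive double curve $C_2=\pi^{-1}(0)$ with underlying smooth curve $C$. Suppose that the spectrum of $\mathcal C$ is $\begin{pmatrix} 0 & p \\ p & 0 \end{pmatrix}$. For $i=1,2$ and $k>0$ let $C_i^k$ be the infinitesimal neighborhood of order $k$ of $C$ in $\mathcal C_i$ (defined by the ideal sheaf $(\pi_i^k)$), and let $\lambda^{-1}(C_2^{p+1})\in H^1(C,T_C)$ be the class of $C_2^{p+1}$ as an extension of $C_1^p=C_2^p$, relative to the extension $C_1^{p+1}$. Then the point of $\mathbb P(H^1(C,T_C))\cup\{0\}$ corresponding to the double curve $C_2$ is $\mathbb C\cdot\lambda^{-1}(C_2^{p+1})$.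
   Context: Everything is over $\mathbb C$. Let $C$ be a smooth connected projective curve, $T_C$ its tangent sheaf, $\omega_C$ its canonical sheaf. A primitive multiple curve with support $C$ is a Cohen-Macaulay scheme $Y$ with $Y_{red}=C$ such that every closed point has a neighborhood in $Y$ that can be embedded in a smooth surface. Its multiplicity is the smallest integer $n$ such that $\mathcal I_C^n=0$, where $\mathcal I_C$ is the ideal sheaf of $C$ in $Y$; it is a double curve if $n=2$, and then $L=\mathcal I_C$ is a line bundle on $C$, the associated line bundle. A fragmented deformation of length $2$ of the double curve $C_2$ is a flat projective morphism $\pi:\mathcal C\to\mathbb C$ (where $\mathbb C$ may be replaced by a neighborhood of $0$) such that the fibers over $s\neq0$ are disjoint unions of two smooth irreducible projective curves, $\pi^{-1}(0)=C_2$, and $\mathcal C$ has exactly two irreducible components $\mathcal C_1,\mathcal C_2$. These are smooth surfaces, flat over $\mathbb C$, with fiber $C$ over $0$. Put $\pi_i=\pi_{|\mathcal C_i}\in\mathcal O(\mathcal C_i)$, and view $\mathcal O_{\mathcal C,x}\subset\mathcal O_{\mathcal C_1,x}\times\mathcal O_{\mathcal C_2,x}$ for $x\in C$, so that $\pi=(\pi_1,\pi_2)$. Here $L\simeq\mathcal O_C$. Spectrum: there is a unique integer $p>0$ such that $\mathcal I_{C,\mathcal C}/(\pi)$ is generated by the image of $(\pi_1^p,0)$ ($\mathcal I_{C,\mathcal C}$ the ideal sheaf of $C$ in $\mathcal C$), and the spectrum is the matrix with zero diagonal entries and off-diagonal entries $p$. There is then an isomorphism of sheaves of algebras on $C$,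 $\Phi:\mathcal O_{\mathcal C_1}/(\pi_1^p)\to\mathcal O_{\mathcal C_2}/(\pi_2^p)$, with $\Phi(\pi_1)=\pi_2$, inducing the identity on $\mathcal O_C$, such that $\mathcal O_{\mathcal C,x}=\{(\alpha_1,\alpha_2)\,:\,\Phi(\alpha_1\bmod\pi_1^p)=\alpha_2\bmod\pi_2^p\}$ for every $x\in C$. Via $\Phi$ one identifies $C_1^p=C_2^p$, so $C_1^{p+1}$ and $C_2^{p+1}$ are two extensions of $C_1^p$ in primitive multiple curves of multiplicity $p+1$. The map $\lambda$: such extensions are parametrized by $H^1(C,T_C)$ by a bijection $\lambda$ with $\lambda(0)=C_1^{p+1}$. Concretely, choose an affine open cover $(U_i)$ of $C$ and isomorphisms of $\mathbb C[t]$-algebras $\varphi_i^{(k)}:\mathcal O_{C_k^{p+1}}|_{U_i}\simeq\mathcal O_{U_i}[t]/(t^{p+1})$, $k=1,2$, with $\pi_k\mapsto t$, inducing the identity modulo $t$, and such that $\varphi_i^{(1)}$ and $\varphi_i^{(2)}$ correspond to each other modulo $t^p$ via $\Phi$. Let $\theta_{ij}^{(k)}=\varphi_i^{(k)}\circ(\varphi_j^{(k)})^{-1}$ on $U_{ij}=U_i\cap U_j$. Then for $\alpha\in\mathcal O_C(U_{ij})$, $\theta_{ij}^{(2)}(\alpha)-\theta_{ij}^{(1)}(\alpha)=t^pD_{ij}(\alpha)$ with $D_{ij}$ a derivation of $\mathcal O_C(U_{ij})$, and $\lambda^{-1}(C_2^{p+1})$ is the class of the cocycle $(D_{ij})$ in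 $H^1(C,T_C)$. Classification of double curves: a double curve $Y$ with associated smooth curve $C$ and associated line bundle $\mathcal O_C$ yields an exact sequence $0\to\mathcal O_C\to\Omega_{Y|C}\to\omega_C\to0$ with class in $\mathrm{Ext}^1_{\mathcal O_C}(\omega_C,\mathcal O_C)=H^1(C,T_C)$, well defined up to multiplication by a nonzero scalar. The point of $\mathbb P(H^1(C,T_C))\cup\{0\}$ corresponding to $Y$ is the line spanned by this class if it is nonzero, and $0$ if it is zero (which is the case exactly when $Y$ is the trivial double curve). For $w\in H^1(C,T_C)$, $\mathbb C\cdot w$ denotes the line spanned by $w$ if $w\neq0$, and $0$ if $w=0$. *)

(* Defs.v *)
From HB Require Import structures.
From mathcomp Require Import all_boot all_order all_algebra.
From mathcomp Require Import all_classical all_reals topology.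
From mathcomp.real_closed Require Import complex.
From mathcomp.multinomials Require Import (canonicals) mpoly.

Set Implicit Arguments.
Unset Strict Implicit.
Unset Printing Implicit Defensive.

Import GRing.Theory.
Local Open Scope classical_set_scope.
Local Open Scope quotient_scope.
Local Open Scope ring_scope.

Definition rmorph (A B : pzRingType) (f : A -> B) : Prop :=
  zmod_morphism f /\ monoid_morphism f.

(** The quotient ring A/(a); it is the zero ring when a is a unit. *)
Module QuotRing.
Section QuotRing.
Variables (A : comPzRingType) (a : A).

Definition equiv (x y : A) : bool := `[< exists u, x - y = u * a >].

Lemma equiv_is_equiv : equiv_class_of equiv.
Proof.
split=> [x|x y|y x z].
- by apply/asboolP; exists 0; rewrite subrr mul0r.
- by apply/asboolP/asboolP => -[u e]; exists (- u); rewrite mulNr -e opprB.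
- move=> /asboolP[u e] /asboolP[v e']; apply/asboolP; exists (u + v).
  by rewrite mulrDl -e -e' addrA subrK.
Qed.

Canonical equiv_equiv := EquivRelPack equiv_is_equiv.
Canonical equiv_encModRel := defaultEncModRel equiv.

Definition quot := {eq_quot equiv}.
HB.instance Definition _ : EqQuotient A equiv quot := EqQuotient.on quot.
HB.instance Definition _ := Choice.on quot.

Lemma quotP x y : \pi_quot x = \pi_quot y <-> exists u, x - y = u * a.
Proof.
by split=> [/eqP|h]; [rewrite piE => /asboolP|apply/eqP; rewrite piE; apply/asboolP].
Qed.

Lemma quot_reprK x : exists u, x - repr (\pi_quot x) = u * a.
Proof. by apply/quotP; rewrite reprK. Qed.

Definition zero : quot := \pi_quot 0.
Definition one : quot := \pi_quot 1.
Definition opp (x : quot) : quot := \pi_quot (- repr x).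
Definition add (x y : quot) : quot := \pi_quot (repr x + repr y).
Definition mul (x y : quot) : quot := \pi_quot (repr x * repr y).

Lemma pi_opp x : opp (\pi_quot x) = \pi_quot (- x).
Proof.
apply/quotP; have [u e] := quot_reprK x; exists u.
by rewrite -e opprK addrC.
Qed.

Lemma pi_add x y : add (\pi_quot x) (\pi_quot y) = \pi_quot (x + y).
Proof.
apply/esym/quotP; have [u e] := quot_reprK x; have [v e'] := quot_reprK y.
by exists (u + v); rewrite mulrDl -e -e' opprD addrACA.
Qed.

Lemma pi_mul x y : mul (\pi_quot x) (\pi_quot y) = \pi_quot (x * y).
Proof.
apply/esym/quotP; have [u e] := quot_reprK x; have [v e'] := quot_reprK y.
exists (u * y + v * repr (\pi_quot x)).
rewrite mulrDl mulrAC -e [v * _ * _]mulrAC -e' !mulrBl.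
by rewrite [y * repr _]mulrC [repr (\pi_quot y) * _]mulrC addrA subrK.
Qed.

Let piW (P : quot -> Prop) : (forall x, P (\pi_quot x)) -> forall q, P q.
Proof. by move=> h q; rewrite -[q]reprK. Qed.

Lemma addA : associative add.
Proof.
by elim/piW=> x; elim/piW=> y; elim/piW=> z; rewrite !pi_add addrA.
Qed.
Lemma addC : commutative add.
Proof. by elim/piW=> x; elim/piW=> y; rewrite !pi_add addrC. Qed.
Lemma add0 : left_id zero add.
Proof. by elim/piW=> x; rewrite pi_add add0r. Qed.
Lemma addN : left_inverse zero opp add.
Proof. by elim/piW=> x; rewrite pi_opp pi_add addNr. Qed.
HB.instance Definition _ := GRing.isZmodule.Build quot addA addC add0 addN.

Lemma mulA : associative mul.
Proof.
by elim/piW=> x; elim/piW=> y; elim/piW=> z; rewrite !pi_mul mulrA.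
Qed.
Lemma mulC : commutative mul.
Proof. by elim/piW=> x; elim/piW=> y; rewrite !pi_mul mulrC. Qed.
Lemma mul1 : left_id one mul.
Proof. by elim/piW=> x; rewrite pi_mul mul1r. Qed.
Lemma mulD : left_distributive mul add.
Proof.
by elim/piW=> x; elim/piW=> y; elim/piW=> z;
  rewrite !(pi_add, pi_mul) mulrDl.
Qed.
HB.instance Definition _ :=
  GRing.Zmodule_isComPzRing.Build quot mulA mulC mul1 mulD.

Definition cl (x : A) : quot := \pi_quot x.

Lemma cl_zmod_morphism : zmod_morphism cl.
Proof. by move=> x y; rewrite /cl -pi_add -pi_opp. Qed.
Lemma cl_monoid_morphism : monoid_morphism cl.
Proof. by split=> [//|x y]; rewrite /cl -pi_mul. Qed.
HB.instance Definition _ := GRing.isZmodMorphism.Build A quot cl cl_zmod_morphism.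
HB.instance Definition _ :=
  GRing.isMonoidMorphism.Build A quot cl cl_monoid_morphism.

Lemma clP (x y : A) : cl x = cl y <-> exists u, x - y = u * a.
Proof. exact: quotP. Qed.

End QuotRing.
End QuotRing.
HB.export QuotRing.

Notation quot := QuotRing.quot.
Notation cl := QuotRing.cl.

Section Algebra.
Variable A : comNzRingType.

Definition is_ideal (I : set A) : Prop :=
  [/\ I 0, (forall a b, I a -> I b -> I (a + b)) &
      (forall a b, I b -> I (a * b))].

Definition prime_ideal (P : set A) : Prop :=
  [/\ is_ideal P, ~ P 1 & forall a b, P (a * b) -> P a \/ P b].

Definition ideal_gen (n : nat) (g : 'I_n -> A) : set A :=
  [set a | exists c : 'I_n -> A, a = \sum_(i < n) c i * g i].

Definition noetherian : Prop :=
  forall I, is_ideal I -> exists n (g : 'I_n -> A), I = ideal_gen g.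

Definition prime_chain (d : nat) : Prop :=
  exists P : nat -> set A, (forall i, (i <= d)%N -> prime_ideal (P i)) /\
    (forall i, (i < d)%N -> P i `<` P i.+1).

Definition krull_dim (d : nat) : Prop := prime_chain d /\ ~ prime_chain d.+1.

Definition reduced : Prop := forall (a : A) n, a ^+ n = 0 -> a = 0.
End Algebra.

Section LocalAlgebra.
Variable A : comUnitRingType.

(** In these two definitions [A] is meant to be a local ring, so that its
    maximal ideal is the set of nonunits. *)
Definition regular_local (d : nat) : Prop :=
  [/\ noetherian A, krull_dim A d &
      exists g : 'I_d -> A, [set a | a \isn't a GRing.unit] = ideal_gen g].

Definition cohen_macaulay_local : Prop :=
  noetherian A /\ exists d, krull_dim A d /\
    exists g : nat -> A, forall i, (i < d)%N ->
      g i \isn't a GRing.unit /\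
      forall a, ideal_gen (fun j : 'I_i => g j) (g i * a) ->
                ideal_gen (fun j : 'I_i => g j) a.
End LocalAlgebra.

Section Flat.
Variables (A B : comNzRingType) (phi : A -> B).

Definition semilin (N : lmodType A) (M : lmodType B) (g : N -> M) : Prop :=
  zmod_morphism g /\ forall a n, g (a *: n) = phi a *: g n.

(** [T], with [beta], is the tensor product of [B] and [N] over [A]. *)
Definition base_change (N : lmodType A) (T : lmodType B) (beta : N -> T) :
    Prop :=
  semilin beta /\
  forall (M : lmodType B) (g : N -> M), semilin g ->
    exists h : {linear T -> M}, (forall n, h (beta n) = g n) /\
      forall h' : {linear T -> M}, (forall n, h' (beta n) = g n) -> h' =1 h.

Definition flat_hom : Prop :=
  forall (N' N : lmodType A) (T' T : lmodType B) (beta' : N' -> T')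
    (beta : N -> T) (u : {linear N' -> N}) (v : {linear T' -> T}),
  base_change beta' -> base_change beta ->
  (forall n, v (beta' n) = beta (u n)) ->
  injective u -> injective v.
End Flat.

(** A sheaf of local [k]-algebras is given as an étalé space: by its stalks
    and by its continuous sections. A section over an open [U] is a family [s]
    of elements of the stalks (only the values on [U] matter) such that
    [reg s x] for all [x] in [U]; [reg s x] says that near [x] the family [s]
    is a continuous section of the étalé space. Restriction and gluing of
    sections are then automatic. *)
Record lrSpace (k : fieldType) := LRSpace {
  pt :> topologicalType;
  stalk : pt -> comUnitRingType;
  cst : forall x, {rmorphism k -> stalk x};
  reg : (forall x, stalk x) -> set pt;
  reg_open : forall s, open (reg s);
  reg_germ : forall s s' x,
    (\forall y \near x, s y = s' y) -> reg s x -> reg s' x;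
  reg_cst : forall c x, reg (fun y => cst y c) x;
  regB : forall s s' x, reg s x -> reg s' x -> reg (fun y => s y - s' y) x;
  regM : forall s s' x, reg s x -> reg s' x -> reg (fun y => s y * s' y) x;
  reg_ex : forall x (a : stalk x), exists2 s, reg s x & s x = a;
  reg_eq0 : forall s x, reg s x -> s x = 0 -> \forall y \near x, s y = 0;
  stalk_local : forall x (a b : stalk x), a + b \is a GRing.unit ->
    a \is a GRing.unit \/ b \is a GRing.unit
}.

Arguments stalk {k} l x.
Arguments cst {k l} x.

Section Spec.
Variables (k : fieldType) (X : lrSpace k).

(** [(U, O_X|U)] is the spectrum of [A], with [rho a] the section of [O_X] on
    [U] defined by [a]: the points of [U] are the primes of [A], the principal
    open sets are a basis of the topology, and the stalks are the localizations
    of [A] at its primes. *)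
Record is_spec (U : set X) (A : comNzRingType)
    (rho : A -> forall x, stalk X x) : Prop := IsSpec {
  spec_open : open U;
  spec_reg : forall a, U `<=` reg (rho a);
  spec_rmorph : forall x, U x -> rmorph (fun a => rho a x);
  spec_prime : forall P : set A, prime_ideal P <->
    exists2 x, U x & P = [set a | rho a x \isn't a GRing.unit];
  spec_inj : forall x y, U x -> U y ->
    [set a | rho a x \isn't a GRing.unit] =
    [set a | rho a y \isn't a GRing.unit] -> x = y;
  spec_basis : forall x (V : set X), U x -> open V -> V x ->
    exists2 a, rho a x \is a GRing.unit &
      forall y, U y -> rho a y \is a GRing.unit -> V y;
  spec_frac : forall x (z : stalk X x), U x ->
    exists a b, rho b x \is a GRing.unit /\ z = rho a x / rho b x;
  spec_eq0 : forall x a, U x -> rho a x = 0 ->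
    exists2 b, rho b x \is a GRing.unit & b * a = 0
}.

Definition affine_open (U : set X) : Prop :=
  exists (A : comNzRingType) (rho : A -> forall x, stalk X x), is_spec U rho.
End Spec.

Record scheme (k : fieldType) := Scheme {
  space :> lrSpace k;
  scheme_affine : forall x : space, exists2 U, affine_open U & U x
}.

Record mor (k : fieldType) (X Y : scheme k) := Mor {
  mfun :> X -> Y;
  mor_cont : continuous mfun;
  pb : forall x, {rmorphism stalk Y (mfun x) -> stalk X x};
  pb_local : forall x a, pb x a \is a GRing.unit -> a \is a GRing.unit;
  pb_cst : forall x c, pb x (cst (mfun x) c) = cst x c;
  pb_reg : forall s x, reg s (mfun x) -> reg (fun y => pb y (s (mfun y))) x
}.

Arguments pb {k X Y} m x.

Section Morphisms.
Variable k : fieldType.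
Implicit Types C F S X Y Z : scheme k.

Program Definition idmor X : mor X X :=
  @Mor k X X id _ (fun x => idfun) _ _ _.
Next Obligation. by move=> X x; exact: cvg_id. Qed.
Next Obligation. by []. Qed.
Next Obligation. by []. Qed.
Next Obligation. by []. Qed.

Program Definition comp X Y Z (g : mor Y Z) (f : mor X Y) : mor X Z :=
  @Mor k X Z (g \o f) _ (fun x => pb f x \o pb g (f x)) _ _ _.
Next Obligation.
move=> X Y Z g f x; apply: continuous_comp; exact: mor_cont.
Qed.
Next Obligation. by move=> X Y Z g f x a /= /pb_local/pb_local. Qed.
Next Obligation. by move=> X Y Z g f x c /=; rewrite !pb_cst. Qed.
Next Obligation.
move=> X Y Z g f s x /= sx.
exact: (@pb_reg _ _ _ f (fun y => pb g y (s (g y))) x (pb_reg sx)).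
Qed.

(** The map on stalks, from the stalk at a point [y] equal to [f x]. *)
Definition pull X Y (f : mor X Y) x y (e : f x = y) : stalk Y y -> stalk X x :=
  match e in _ = y return stalk Y y -> stalk X x with erefl => pb f x end.

Definition pbf X Y (f : mor X Y) (t : forall y, stalk Y y) :
    forall x, stalk X x :=
  fun x => pb f x (t (f x)).

(** Continuity at [x] of a section of the inverse image sheaf of [O_Y]. *)
Definition reg_along X Y (f : mor X Y) (q : forall x, stalk Y (f x)) (x : X) :
    Prop :=
  exists2 s, reg s (f x) & \forall y \near x, q y = s (f y).

Definition open_immersion X Y (f : mor X Y) : Prop :=
  [/\ injective f, (forall U, open U -> open (f @` U)) &
      forall x, bijective (pb f x)].

Definition closed_immersion X Y (f : mor X Y) : Prop :=
  [/\ injective f, closed (range f),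
      (forall U, open U -> exists2 V, open V & U = f @^-1` V) &
      forall x (a : stalk X x), exists b, pb f x b = a].

(** [f] is the closed subscheme of [Y] defined by the ideal sheaf [(h)]. *)
Definition cut_out X Y (f : mor X Y) (h : forall y, stalk Y y) : Prop :=
  [/\ closed_immersion f, range f = [set y | h y \isn't a GRing.unit] &
      forall x a, pb f x a = 0 <-> exists u, a = u * h (f x)].

Definition flat_mor X Y (f : mor X Y) : Prop := forall x, flat_hom (pb f x).

(** [h] is the structure of a scheme over Spec [A], where [A] is a [k]-algebra
    through [kappa]. *)
Definition is_over X (A : comNzRingType) (kappa : {rmorphism k -> A})
    (h : A -> forall x, stalk X x) : Prop :=
  [/\ forall a x, reg (h a) x, forall x, rmorph (fun a => h a x) &
      forall c x, h (kappa c) x = cst x c].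

(** [X], with structure [h], is the projective space of dimension [n] over
    Spec [A]: [U i] is the standard affine chart, and [u i j] is the function
    x_j / x_i on it. *)
Definition is_proj_space X (A : comNzRingType) (h : A -> forall x, stalk X x)
    (n : nat) : Prop :=
  exists (U : 'I_n.+1 -> set X)
         (u : 'I_n.+1 -> 'I_n.+1 -> forall x, stalk X x),
  [/\ forall x, exists i, U i x,
      forall i, @is_spec k X (U i) (mpoly.mpoly n A) (fun p x =>
        mpoly.mmap (fun a => h a x) (fun l => u i (lift i l) x) p),
      forall i x, U i x -> u i i x = 1,
      forall i j x, U i x -> (U j x <-> u i j x \is a GRing.unit) &
      forall i j l x, U i x -> U j x -> u i l x = u i j x * u j l x].

Definition projective_over X (A : comNzRingType) (kappa : {rmorphism k -> A})
    (h : A -> forall x, stalk X x) : Prop :=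
  exists n (P : scheme k) (hP : A -> forall x, stalk P x) (i : mor X P),
  [/\ is_over kappa hP, is_proj_space hP n, closed_immersion i &
      forall a x, h a x = pbf i (hP a) x].

Definition projective_mor X S (f : mor X S) : Prop :=
  exists (A : comNzRingType) (kappa : {rmorphism k -> A})
         (rho : A -> forall s, stalk S s),
  [/\ is_spec setT rho, is_over kappa rho &
      projective_over kappa (fun a => pbf f (rho a))].

Definition projective X : Prop :=
  @projective_over X k idfun (fun c x => cst x c).

Definition irreducible_set X (A : set X) : Prop :=
  A !=set0 /\ forall U V, open U -> open V -> A `&` U !=set0 ->
    A `&` V !=set0 -> A `&` (U `&` V) !=set0.

Definition irreducible_component X (A : set X) : Prop :=
  irreducible_set A /\ forall B, irreducible_set B -> A `<=` B -> B = A.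

Definition locally_of_finite_type X : Prop :=
  forall x : X, exists (U : set X) (A : comNzRingType)
    (rho : A -> forall x, stalk X x) (kappa : {rmorphism k -> A}),
  [/\ U x, is_spec U rho, (forall c y, U y -> rho (kappa c) y = cst y c) &
      exists n (g : 'I_n -> A), forall a,
        exists p : mpoly.mpoly n k, a = mpoly.mmap kappa g p].

(** Nonsingular of pure dimension [d]; this is smoothness over [k] when [k] is
    algebraically closed. *)
Definition smooth (d : nat) X : Prop :=
  locally_of_finite_type X /\
  forall x : X, closed [set x] -> regular_local (stalk X x) d.

Definition smooth_irreducible_projective_curve X : Prop :=
  [/\ smooth 1 X, irreducible_set [set: X] & projective X].

Definition smooth_connected_projective_curve X : Prop :=
  [/\ smooth 1 X, [set: X] !=set0, connected [set: X] & projective X].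

Definition cohen_macaulay X : Prop :=
  (forall x : X, exists (U : set X) (A : comNzRingType)
     (rho : A -> forall x, stalk X x),
     [/\ U x, is_spec U rho & noetherian A]) /\
  forall x : X, cohen_macaulay_local (stalk X x).

Definition is_reduction C Y (b : mor C Y) : Prop :=
  [/\ closed_immersion b, range b = [set: Y] &
      forall x, reduced (stalk C x)].

(** [I ^ n = 0], where [I] is the ideal sheaf of [C] in [Y]. *)
Definition ideal_power_zero C Y (b : mor C Y) (n : nat) : Prop :=
  forall x (a : 'I_n -> stalk Y (b x)),
    (forall i, pb b x (a i) = 0) -> \prod_(i < n) a i = 0.

Definition multiplicity C Y (b : mor C Y) (n : nat) : Prop :=
  ideal_power_zero b n /\ forall m, ideal_power_zero b m -> (n <= m)%N.

Definition primitive_multiple_curve C Y (b : mor C Y) : Prop :=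
  [/\ smooth_connected_projective_curve C, is_reduction b, cohen_macaulay Y &
      forall y : Y, closed [set y] ->
        exists (V : scheme k) (o : mor V Y) (S : scheme k) (e : mor V S),
        [/\ open_immersion o, range o y, smooth 2 S & closed_immersion e]].

Definition double_curve C Y (b : mor C Y) : Prop :=
  primitive_multiple_curve b /\ multiplicity b 2.

(** [S] is the affine line over [k], with coordinate [t], or a principal open
    neighborhood [g != 0] of the origin in it ([g = 1] gives the line). *)
Definition line_nbhd S (t : forall s, stalk S s) : Prop :=
  exists (g : {poly k}) (A : comNzRingType) (iota : {rmorphism {poly k} -> A})
         (rho : A -> forall s, stalk S s),
  [/\ g.[0] != 0,
      [/\ exists v, iota g * v = 1, injective iota &
          forall a, exists n p, a * iota g ^+ n = iota p],
      is_spec setT rho, forall c s, rho (iota c%:P) s = cst s c &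
      forall s, t s = rho (iota 'X) s].

Definition fibre X S (f : mor X S) (t : forall s, stalk S s) (c : k)
    (F : scheme k) (i : mor F X) : Prop :=
  cut_out i (fun x => pbf f t x - cst x c).

Definition disjoint_union_of_two_curves F : Prop :=
  exists (A B : scheme k) (a : mor A F) (b : mor B F),
  [/\ smooth_irreducible_projective_curve A,
      smooth_irreducible_projective_curve B,
      open_immersion a, open_immersion b &
      range a `&` range b = set0 /\ range a `|` range b = [set: F]].

(** [f : X -> S] is a fragmented deformation of length 2 of the double curve
    [Y], with reduction [b : C -> Y]; [e] embeds [Y] in [X] as the fibre over
    0, [i1] and [i2] are the embeddings of the irreducible components [X1] and
    [X2], and [j1], [j2] embed [C] in them as the fibres over 0. *)
Record fragmented_deformation S (t : forall s, stalk S s) X (f : mor X S)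
    C Y (b : mor C Y) (e : mor Y X) X1 X2 (i1 : mor X1 X) (i2 : mor X2 X)
    (j1 : mor C X1) (j2 : mor C X2) : Prop := FragmentedDeformation {
  frag_base : line_nbhd t;
  frag_flat : flat_mor f;
  frag_proj : projective_mor f;
  frag_fibre : forall c, c != 0 ->
    (exists s, t s - cst s c \isn't a GRing.unit) ->
    exists F (i : mor F X), fibre f t c i /\ disjoint_union_of_two_curves F;
  frag_fibre0 : fibre f t 0 e;
  frag_double : double_curve b;
  frag_imm1 : closed_immersion i1;
  frag_imm2 : closed_immersion i2;
  frag_comp : forall A, irreducible_component A <->
    A = range i1 \/ A = range i2;
  frag_two : range i1 <> range i2;
  frag_smooth1 : smooth 2 X1;
  frag_smooth2 : smooth 2 X2;
  frag_flat1 : flat_mor (comp f i1);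
  frag_flat2 : flat_mor (comp f i2);
  frag_fibre1 : fibre (comp f i1) t 0 j1;
  frag_fibre2 : fibre (comp f i2) t 0 j2;
  frag_ij1 : comp i1 j1 = comp e b;
  frag_ij2 : comp i2 j2 = comp e b
}.

Section TwoComponents.
Variables (X C X1 X2 : scheme k) (i1 : mor X1 X) (i2 : mor X2 X).
Variables (j1 : mor C X1) (j2 : mor C X2) (pi : forall x, stalk X x).

Let pi1 := pbf i1 pi.
Let pi2 := pbf i2 pi.

(** At every point [x] of [C], lying over the point [y] of [X], the element
    [xi = (pi1 ^ p, 0)] belongs to the stalk of [O_X] and generates
    [I_(C,X) / (pi)]. *)
Definition spectrum_exponent (p : nat) : Prop :=
  (0 < p)%N /\
  forall (x : C) (y : X) (e1 : i1 (j1 x) = y) (e2 : i2 (j2 x) = y),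
  exists xi : stalk X y,
  [/\ pull e1 xi = pi1 (j1 x) ^+ p, pull e2 xi = 0 &
      forall a, pb j1 x (pull e1 a) = 0 <-> exists u v, a = u * xi + v * pi y].

Definition has_spectrum (M : 'M[nat]_2) : Prop :=
  exists2 p, spectrum_exponent p &
    M = \matrix_(i, j) (if i == j then 0%N else p).

(** Continuity at [x] of a section of the sheaf on [C] with stalks
    [O_(X1,x) / (h)]. *)
Definition reg_quot Z (j : mor C Z) (h : forall z, stalk Z z)
    (q : forall x, quot (h (j x))) (x : C) : Prop :=
  exists2 s, reg s (j x) & \forall y \near x, q y = cl (h (j y)) (s (j y)).

(** [Phi] is an isomorphism of sheaves of algebras on [C] from
    [O_X1 / (pi1 ^ p)] to [O_X2 / (pi2 ^ p)], with [Phi pi1 = pi2], inducing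
    the identity on [O_C], and identifying the stalk of [O_X] at each point of
    [C] with the subring of the pairs [(a1, a2)] such that [Phi a1 = a2]. *)
Record gluing_iso (p : nat)
    (Phi : forall x, quot (pi1 (j1 x) ^+ p) -> quot (pi2 (j2 x) ^+ p)) :
    Prop := GluingIso {
  glue_rmorph : forall x, rmorph (Phi x);
  glue_bij : forall x, bijective (Phi x);
  glue_reg : forall q x, reg_quot (h := fun z => pi1 z ^+ p) q x ->
    reg_quot (h := fun z => pi2 z ^+ p) (fun y => Phi y (q y)) x;
  glue_cst : forall x c, Phi x (cl _ (cst (j1 x) c)) = cl _ (cst (j2 x) c);
  glue_pi : forall x, Phi x (cl _ (pi1 (j1 x))) = cl _ (pi2 (j2 x));
  glue_id : forall x a1 a2, Phi x (cl _ a1) = cl _ a2 ->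
    pb j1 x a1 = pb j2 x a2;
  glue_inj : forall x y (e1 : i1 (j1 x) = y) (e2 : i2 (j2 x) = y)
    (a : stalk X y), pull e1 a = 0 -> pull e2 a = 0 -> a = 0;
  glue_image : forall x y (e1 : i1 (j1 x) = y) (e2 : i2 (j2 x) = y) a1 a2,
    (exists2 a : stalk X y, pull e1 a = a1 & pull e2 a = a2) <->
    Phi x (cl _ a1) = cl _ a2
}.
End TwoComponents.

Section Trivializations.
Variables (C Z : scheme k) (j : mor C Z) (h : forall z, stalk Z z) (n : nat).

(** The stalks of the structure sheaf of the [n]-th infinitesimal neighborhood
    [(h ^ n)] of [C] in [Z], and of [O_C[t]/(t ^ n)]. *)
Definition nbhd_stalk (x : C) := quot (h (j x) ^+ n).
Definition trunc_stalk (x : C) := quot ('X^n : {poly stalk C x}).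

Definition reg_trunc (q : forall x, trunc_stalk x) (x : C) : Prop :=
  exists2 c : nat -> forall x, stalk C x, forall m, reg (c m) x &
    \forall y \near x, q y = cl _ (\poly_(m < n) c m y).

(** [phi], with inverse [psi], is an isomorphism over [U] of sheaves of
    [k[t]]-algebras, mapping [h] to [t] and inducing the identity modulo
    [t]. *)
Record trivialization (U : set C) (phi : forall x, nbhd_stalk x -> trunc_stalk x)
    (psi : forall x, trunc_stalk x -> nbhd_stalk x) : Prop := Trivialization {
  triv_rmorph : forall x, U x -> rmorph (phi x);
  triv_K : forall x, U x -> cancel (phi x) (psi x);
  triv_VK : forall x, U x -> cancel (psi x) (phi x);
  triv_reg : forall q x, U x -> reg_quot (h := fun z => h z ^+ n) q x ->
    reg_trunc (fun y => phi y (q y)) x;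
  triv_cst : forall x c, U x ->
    phi x (cl _ (cst (j x) c)) = cl _ (cst x c)%:P;
  triv_t : forall x, U x -> phi x (cl _ (h (j x))) = cl _ 'X;
  triv_id : forall x a, U x ->
    exists u, phi x (cl _ a) - cl _ (pb j x a)%:P = u * cl _ 'X
}.
End Trivializations.
End Morphisms.

Section Cohomology.
Variables (k : fieldType) (C : scheme k).

Definition field_of_maps := forall x : C, stalk C x -> stalk C x.
Implicit Types D e : field_of_maps.

(** [D] is a section over [U] of the tangent sheaf, i.e. a [k]-derivation of
    the sheaf of algebras [O_C|U]. *)
Record derivation_on (U : set C) D : Prop := DerivationOn {
  der_add : forall x, U x -> zmod_morphism (D x);
  der_mul : forall x a b, U x -> D x (a * b) = a * D x b + b * D x a;
  der_cst : forall x c, U x -> D x (cst x c) = 0;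
  der_reg : forall s x, U x -> reg s x -> reg (fun y => D y (s y)) x
}.

Unset Implicit Arguments.

(** Čech 1-cocycles on arbitrary open covers of [C]. *)
Record cocycle := Cocycle {
  idx : Type;
  cov : idx -> set C;
  cov_open : forall i, open (cov i);
  cov_full : forall x, exists i, cov i x;
  coc : idx -> idx -> field_of_maps;
  coc_der : forall i j, derivation_on (cov i `&` cov j) (coc i j);
  cocP : forall i j l x a, cov i x -> cov j x -> cov l x ->
    coc i j x a + coc j l x a = coc i l x a
}.

Set Implicit Arguments.
Arguments cov {c} _ _.
Arguments coc {c} _ _ _ _.
Arguments cocP {c i j l x} a _ _ _.
Arguments coc_der {c} i j.

(** Equality in the direct limit over the open covers: the two cocycles differ
    by a coboundary on some common refinement. *)
Definition cohomologous (z z' : cocycle) : Prop :=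
  exists (J : Type) (V : J -> set C) (r : J -> idx z) (r' : J -> idx z')
         (e : J -> field_of_maps),
  [/\ forall j, open (V j) /\ V j `<=` cov (r j) `&` cov (r' j),
      forall x, exists j, V j x,
      forall j, derivation_on (V j) (e j) &
      forall j l x a, V j x -> V l x ->
        coc (r j) (r l) x a - coc (r' j) (r' l) x a = e j x a - e l x a].

Lemma regN s (x : C) : reg s x -> reg (fun y => - s y) x.
Proof.
move=> sx; have := regB (regB sx sx) sx; apply: reg_germ.
by near=> y; rewrite subrr sub0r.
Unshelve. all: by end_near.
Qed.

Lemma regD s s' (x : C) : reg s x -> reg s' x -> reg (fun y => s y + s' y) x.
Proof.
move=> sx s'x; have := regB sx (regN s'x); apply: reg_germ.
by near=> y; rewrite opprK.
Unshelve. all: by end_near.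
Qed.

Lemma derivation_onS (U V : set C) D :
  V `<=` U -> derivation_on U D -> derivation_on V D.
Proof.
by move=> VU [h1 h2 h3 h4]; split=> *; [apply: h1|apply: h2|apply: h3|apply: h4];
  rewrite //; apply: VU.
Qed.

Lemma derivation_on0 (U : set C) : derivation_on U (fun _ _ => 0).
Proof.
split=> [x _ a b|x a b _|//|s x _ _]; rewrite ?subr0 ?mulr0 ?addr0 //.
have := reg_cst 0 x; apply: reg_germ.
by near=> y; rewrite rmorph0.
Unshelve. all: by end_near.
Qed.

Lemma derivation_onD (U : set C) D D' :
  derivation_on U D -> derivation_on U D' ->
  derivation_on U (fun x a => D x a + D' x a).
Proof.
move=> [h1 h2 h3 h4] [h1' h2' h3' h4']; split.
- by move=> x Ux a b; rewrite h1 // h1' // opprD addrACA.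
- by move=> x a b Ux; rewrite h2 // h2' // !mulrDr addrACA.
- by move=> x c Ux; rewrite h3 // h3' // addr0.
- by move=> s x Ux sx; apply: regD; [apply: h4|apply: h4'].
Qed.

Lemma derivation_onZ c (U : set C) D :
  derivation_on U D -> derivation_on U (fun x a => cst x c * D x a).
Proof.
move=> [h1 h2 h3 h4]; split.
- by move=> x Ux a b; rewrite h1 // mulrBr.
- by move=> x a b Ux; rewrite h2 // mulrDr mulrCA [cst x c * (b * _)]mulrCA.
- by move=> x c' Ux; rewrite h3 // mulr0.
- by move=> s x Ux sx; apply: regM (reg_cst _ _) (h4 _ _ Ux sx).
Qed.

Lemma derivation_onN (U : set C) D :
  derivation_on U D -> derivation_on U (fun x a => - D x a).
Proof.
move=> [h1 h2 h3 h4]; split.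
- by move=> x Ux a b; rewrite h1 // opprD.
- by move=> x a b Ux; rewrite h2 // !mulrN opprD.
- by move=> x c Ux; rewrite h3 // oppr0.
- by move=> s x Ux sx; apply: regN (h4 _ _ Ux sx).
Qed.

Lemma coc_ii (z : cocycle) i x a : cov (c := z) i x -> coc i i x a = 0.
Proof. by move=> ix; apply: (addrI (coc i i x a)); rewrite cocP // addr0. Qed.

Lemma coc_sym (z : cocycle) i j x a :
  cov (c := z) i x -> cov (c := z) j x -> coc i j x a = - coc j i x a.
Proof. by move=> ix jx; apply/eqP; rewrite -addr_eq0 cocP // coc_ii. Qed.

Lemma cohomologous_eq (z z' : cocycle) J (V : J -> set C)
    (r : J -> idx z) (r' : J -> idx z') :
  (forall j, open (V j) /\ V j `<=` cov (r j) `&` cov (r' j)) ->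
  (forall x, exists j, V j x) ->
  (forall j l x a, V j x -> V l x ->
    coc (r j) (r l) x a = coc (r' j) (r' l) x a) ->
  cohomologous z z'.
Proof.
move=> hV Vx h; exists J, V, r, r', (fun _ _ _ => 0); split=> //.
  by move=> j; apply: derivation_on0.
by move=> j l x a jx lx; rewrite h // !subrr.
Qed.

Lemma cohomologous_refl z : cohomologous z z.
Proof.
apply: (@cohomologous_eq z z (idx z) (@cov z) id id) => //.
- by move=> j; split=> [|x jx]; [apply: cov_open|].
- exact: cov_full.
Qed.

Lemma cohomologous_sym z z' : cohomologous z z' -> cohomologous z' z.
Proof.
move=> [J [V [r [r' [e [hV Vx he h]]]]]].
exists J, V, r', r, (fun j x a => - e j x a); split=> //.
- by move=> j; have [oV sV] := hV j; split=> // x /sV[].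
- by move=> j; apply: derivation_onN.
- by move=> j l x a jx lx; rewrite -opprB h // opprB opprK addrC.
Qed.

Lemma cohomologous_trans z z' z'' :
  cohomologous z z' -> cohomologous z' z'' -> cohomologous z z''.
Proof.
move=> [J [V [r [r' [e [hV Vx he h]]]]]] [K [W [q [q' [f [hW Wx hf g]]]]]].
exists (J * K)%type, (fun m => V m.1 `&` W m.2), (r \o fst), (q' \o snd),
  (fun m x a => e m.1 x a + f m.2 x a + coc (r' m.1) (q m.2) x a); split.
- move=> [j l] /=; have [oV sV] := hV j; have [oW sW] := hW l.
  by split=> [|x [/sV[? ?] /sW[? ?]]]; [apply: openI|].
- by move=> x; have [j jx] := Vx x; have [l lx] := Wx x; exists (j, l).
- move=> [j l] /=; have [oV sV] := hV j; have [oW sW] := hW l.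
  apply: derivation_onD; first apply: derivation_onD.
  + by apply: derivation_onS (he j) => x [].
  + by apply: derivation_onS (hf l) => x [].
  + by apply: derivation_onS (coc_der _ _) => x [/sV[? ?] /sW[? ?]].
- move=> [j l] [j' l'] x a /= [jx lx] [jx' lx'].
  have [_ /(_ _ jx)[rj r'j]] := hV j; have [_ /(_ _ jx')[rj' r'j']] := hV j'.
  have [_ /(_ _ lx)[ql q'l]] := hW l; have [_ /(_ _ lx')[ql' q'l']] := hW l'.
  have E1 := h j j' x a jx jx'; have E2 := g l l' x a lx lx'.
  have E3 : coc (r' j) (r' j') x a - coc (q l) (q l') x a =
            coc (r' j) (q l) x a - coc (r' j') (q l') x a.
    rewrite -(cocP (c := z') (j := q l)) // -(cocP (c := z') (i := q l) (j := q l') (l := r' j')) //.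
    rewrite [coc (r' j') _ _ _]coc_sym // opprK.
    by rewrite addrA addrAC addrK.
  transitivity ((coc (r j) (r j') x a - coc (r' j) (r' j') x a) +
    (coc (q l) (q l') x a - coc (q' l) (q' l') x a) +
    (coc (r' j) (r' j') x a - coc (q l) (q l') x a)).
    by rewrite [RHS]addrAC !addrA !subrK.
  by rewrite E1 E2 E3 !opprD [RHS]addrACA; congr (_ + _); rewrite addrACA.
Qed.

Definition cohb (z z' : cocycle) : bool := `[< cohomologous z z' >].

HB.instance Definition _ := gen_eqMixin cocycle.
HB.instance Definition _ := gen_choiceMixin cocycle.

Lemma cohb_is_equiv : equiv_class_of cohb.
Proof.
split=> [x|x y|y x z].
- exact/asboolP/cohomologous_refl.
- by apply/asboolP/asboolP; apply: cohomologous_sym.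
- move=> /asboolP xy /asboolP yz; apply/asboolP; exact: cohomologous_trans yz.
Qed.

Canonical cohb_equiv := EquivRelPack cohb_is_equiv.
Canonical cohb_encModRel := defaultEncModRel cohb.

Definition H1T := {eq_quot cohb}.
HB.instance Definition _ : EqQuotient cocycle cohb H1T := EqQuotient.on H1T.
HB.instance Definition _ := Choice.on H1T.

Definition cocl (z : cocycle) : H1T := \pi_H1T z.

Lemma coclP z z' : cocl z = cocl z' <-> cohomologous z z'.
Proof.
by rewrite /cocl; split=> [/eqP|h]; [rewrite piE => /asboolP|apply/eqP; rewrite piE; apply/asboolP].
Qed.

Lemma coclK z : cohomologous z (repr (cocl z)).
Proof. by apply/coclP; rewrite /cocl reprK. Qed.

Program Definition coc0 : cocycle :=
  @Cocycle unit (fun _ => setT) _ _ (fun _ _ _ _ => 0) _ _.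
Next Obligation. by move=> i; exact: openT. Qed.
Next Obligation. by move=> x; exists tt. Qed.
Next Obligation. by move=> *; exact: derivation_on0. Qed.
Next Obligation. by move=> *; rewrite addr0. Qed.

Program Definition cocD (z z' : cocycle) : cocycle :=
  @Cocycle (idx z * idx z')%type (fun m => cov m.1 `&` cov m.2) _ _
    (fun m m' x a => coc m.1 m'.1 x a + coc m.2 m'.2 x a) _ _.
Next Obligation. by move=> z z' m; apply: openI; exact: cov_open. Qed.
Next Obligation.
move=> z z' x; have [i ix] := cov_full z x; have [j jx] := cov_full z' x.
by exists (i, j).
Qed.
Next Obligation.
move=> z z' m m'; apply: derivation_onD.
  by apply: derivation_onS (coc_der m.1 m'.1) => x [[? ?] [? ?]].
by apply: derivation_onS (coc_der m.2 m'.2) => x [[? ?] [? ?]].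
Qed.
Next Obligation.
by move=> z z' i j l x a [? ?] [? ?] [? ?]; rewrite addrACA !cocP.
Qed.

Program Definition cocZ (c : k) (z : cocycle) : cocycle :=
  @Cocycle (idx z) (@cov z) _ _ (fun i j x a => cst x c * coc i j x a) _ _.
Next Obligation. by move=> c z m; exact: cov_open. Qed.
Next Obligation. by move=> c z x; exact: cov_full. Qed.
Next Obligation. by move=> c z i j; apply: derivation_onZ; exact: coc_der. Qed.
Next Obligation. by move=> c z i j l x a ? ? ?; rewrite -mulrDr cocP. Qed.

Lemma cocD_coh z1 z1' z2 z2' : cohomologous z1 z1' -> cohomologous z2 z2' ->
  cohomologous (cocD z1 z2) (cocD z1' z2').
Proof.
move=> [J [V [r [r' [e [hV Vx he h]]]]]] [K [W [q [q' [f [hW Wx hf g]]]]]].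
exists (J * K)%type, (fun m => V m.1 `&` W m.2), (fun m => (r m.1, q m.2)),
  (fun m => (r' m.1, q' m.2)), (fun m x a => e m.1 x a + f m.2 x a); split.
- move=> [j l] /=; have [oV sV] := hV j; have [oW sW] := hW l.
  by split=> [|x [/sV[? ?] /sW[? ?]]]; [apply: openI|].
- by move=> x; have [j jx] := Vx x; have [l lx] := Wx x; exists (j, l).
- move=> [j l] /=; apply: derivation_onD.
  + by apply: derivation_onS (he j) => x [].
  + by apply: derivation_onS (hf l) => x [].
- move=> [j l] [j' l'] x a /= [jx lx] [jx' lx'].
  by rewrite opprD addrACA h // g // opprD addrACA.
Qed.

Lemma cocZ_coh c z z' :
  cohomologous z z' -> cohomologous (cocZ c z) (cocZ c z').
Proof.
move=> [J [V [r [r' [e [hV Vx he h]]]]]].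
exists J, V, r, r', (fun j x a => cst x c * e j x a); split=> //.
- by move=> j; apply: derivation_onZ.
- by move=> j l x a jx lx /=; rewrite -!mulrBr h.
Qed.

Definition H1_add (u v : H1T) : H1T := cocl (cocD (repr u) (repr v)).
Definition H1_scale (c : k) (u : H1T) : H1T := cocl (cocZ c (repr u)).
Definition H1_opp (u : H1T) : H1T := H1_scale (-1) u.

Lemma cocl_add z z' : H1_add (cocl z) (cocl z') = cocl (cocD z z').
Proof.
by apply/coclP/cohomologous_sym/cocD_coh; apply: coclK.
Qed.

Lemma cocl_scale c z : H1_scale c (cocl z) = cocl (cocZ c z).
Proof. by apply/coclP/cohomologous_sym/cocZ_coh; apply: coclK. Qed.

Lemma coclW (P : H1T -> Prop) : (forall z, P (cocl z)) -> forall u, P u.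
Proof. by move=> h u; rewrite -[u]reprK. Qed.

Lemma H1_addA : associative H1_add.
Proof.
elim/coclW=> x; elim/coclW=> y; elim/coclW=> z; rewrite !cocl_add.
apply/coclP; apply: (@cohomologous_eq (cocD x (cocD y z)) (cocD (cocD x y) z)
  (idx x * idx y * idx z)%type
  (fun m => cov m.1.1 `&` cov m.1.2 `&` cov m.2)
  (fun m => (m.1.1, (m.1.2, m.2))) id) => [m||].
- split=> [|t [[? ?] ?] //]; apply: openI; last exact: cov_open.
  by apply: openI; exact: cov_open.
- move=> t; have [i it] := cov_full x t; have [j jt] := cov_full y t.
  by have [l lt] := cov_full z t; exists (i, j, l).
- by move=> m m' t a _ _ /=; rewrite addrA.
Qed.

Lemma H1_addC : commutative H1_add.
Proof.
elim/coclW=> x; elim/coclW=> y; rewrite !cocl_add.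
apply/coclP; apply: (@cohomologous_eq (cocD x y) (cocD y x) (idx x * idx y)%type
  (fun m => cov m.1 `&` cov m.2) id (fun m => (m.2, m.1))) => [m||].
- by split=> [|t [? ?] //]; apply: openI; exact: cov_open.
- move=> t; have [i it] := cov_full x t; have [j jt] := cov_full y t.
  by exists (i, j).
- by move=> m m' t a _ _ /=; rewrite addrC.
Qed.

Lemma H1_add0 : left_id (cocl coc0) H1_add.
Proof.
elim/coclW=> x; rewrite !cocl_add; apply/coclP.
apply: (@cohomologous_eq (cocD coc0 x) x (idx x) (@cov x) (fun i => (tt, i)) id).
- by move=> i; split=> //; exact: cov_open.
- exact: cov_full.
- by move=> i j t a _ _ /=; rewrite add0r.
Qed.

Lemma H1_addN : left_inverse (cocl coc0) H1_opp H1_add.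
Proof.
elim/coclW=> x; rewrite /H1_opp cocl_scale cocl_add; apply/coclP.
apply: (@cohomologous_eq (cocD (cocZ (-1) x) x) coc0 (idx x) (@cov x)
  (fun i => (i, i)) (fun=> tt)).
- by move=> i; split=> //; exact: cov_open.
- exact: cov_full.
- by move=> i j t a _ _ /=; rewrite rmorphN1 mulN1r addNr.
Qed.

HB.instance Definition _ :=
  GRing.isZmodule.Build H1T H1_addA H1_addC H1_add0 H1_addN.

Let cocl_same (z z' : cocycle) (r : idx z -> idx z') :
  (forall i, cov i `<=` cov (r i)) ->
  (forall i j x a, coc i j x a = coc (r i) (r j) x a) -> cocl z = cocl z'.
Proof.
move=> hr h; apply/coclP.
apply: (@cohomologous_eq z z' (idx z) (@cov z) id r).
- by move=> i; split=> [|x ix]; [exact: cov_open|split=> //; exact: hr].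
- exact: cov_full.
- by move=> i j x a _ _; rewrite h.
Qed.

Lemma H1_scaleA c d u : H1_scale c (H1_scale d u) = H1_scale (c * d) u.
Proof.
elim/coclW: u => z; rewrite !cocl_scale.
apply: (@cocl_same (cocZ c (cocZ d z)) (cocZ (c * d) z) id) => [i x //|i j x a /=].
by rewrite rmorphM mulrA.
Qed.

Lemma H1_scale1 : left_id 1 H1_scale.
Proof.
elim/coclW=> z; rewrite !cocl_scale.
by apply: (@cocl_same (cocZ 1 z) z id) => [i x //|i j x a /=]; rewrite rmorph1 mul1r.
Qed.

Lemma H1_scaleDr : right_distributive H1_scale +%R.
Proof.
move=> c; elim/coclW=> z; elim/coclW=> z'.
have addE y y' : cocl y + cocl y' = cocl (cocD y y') := cocl_add y y'.
rewrite addE !cocl_scale addE.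
apply: (@cocl_same (cocZ c (cocD z z')) (cocD (cocZ c z) (cocZ c z')) id) =>
  [i x //|i j x a /=].
by rewrite mulrDr.
Qed.

Lemma H1_scaleDl u : {morph H1_scale^~ u : c d / c + d}.
Proof.
elim/coclW: u => z c d.
have addE y y' : cocl y + cocl y' = cocl (cocD y y') := cocl_add y y'.
rewrite !cocl_scale addE.
apply: (@cocl_same (cocZ (c + d) z) (cocD (cocZ c z) (cocZ d z))
  (fun i => (i, i))) => [i x ix|i j x a] /=; first by split.
by rewrite rmorphD mulrDl.
Qed.

HB.instance Definition _ := GRing.Zmodule_isLmodule.Build k H1T
  H1_scaleA H1_scale1 H1_scaleDr H1_scaleDl.

(** The point of P(H^1(C, T_C)) \cup {0} defined by [w]. *)
Definition span1 (w : H1T) : set H1T := [set v | exists c, v = c *: w].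

End Cohomology.

Arguments cocycle {k} C.
Arguments H1T {k} C.
Arguments idx {k C} _.
Arguments cov {k C c} _ _.
Arguments coc {k C c} _ _ _ _.
Arguments cocP {k C c i j l x} a _ _ _.
Arguments coc_der {k C c} i j.

Section DoubleCurves.
Variable k : fieldType.

(** Sheaves of [O_X]-modules, with the same encoding as for [lrSpace]. *)
Record omodule (X : scheme k) := OModule {
  mstalk : forall x : X, lmodType (stalk X x);
  mreg : (forall x, mstalk x) -> set X;
  mreg_open : forall m, open (mreg m);
  mreg_germ : forall m m' x,
    (\forall y \near x, m y = m' y) -> mreg m x -> mreg m' x;
  mregB : forall m m' x,
    mreg m x -> mreg m' x -> mreg (fun y => m y - m' y) x;
  mregZ : forall s m x, reg s x -> mreg m x -> mreg (fun y => s y *: m y) x;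
  mreg_ex : forall x (v : mstalk x), exists2 m, mreg m x & m x = v;
  mreg_eq0 : forall m x, mreg m x -> m x = 0 -> \forall y \near x, m y = 0
}.

Arguments mstalk {X} o x.

Section Kahler.
Variables (X Y : scheme k) (f : mor X Y).

Definition derivation_along (x : X) (M : lmodType (stalk X x))
    (d : stalk Y (f x) -> M) : Prop :=
  [/\ zmod_morphism d, forall c, d (cst (f x) c) = 0 &
      forall a b, d (a * b) = pb f x a *: d b + pb f x b *: d a].

(** [E], with [d], is the sheaf [f^* Omega_Y] with its universal derivation:
    its stalk at [x] is the tensor product over [O_(Y,f x)] of [O_(X,x)] with
    the module of differentials of [O_(Y,f x)] over [k], which is characterized
    by its universal property. *)
Definition is_differentials (E : omodule X)
    (d : forall x, stalk Y (f x) -> mstalk E x) : Prop :=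
  [/\ forall x, derivation_along (d x),
      forall x (M : lmodType (stalk X x)) (g : stalk Y (f x) -> M),
        derivation_along g ->
        exists l : {linear mstalk E x -> M}, (forall a, l (d x a) = g a) /\
          forall l' : {linear mstalk E x -> M}, (forall a, l' (d x a) = g a) ->
            l' =1 l &
      forall q x, reg_along (f := f) q x -> mreg (fun y => d y (q y)) x].
End Kahler.

Section Extension.
Variables (C : scheme k) (W E : omodule C) (dW : forall x, stalk C x -> mstalk W x).
Variables (alpha : forall x, stalk C x -> mstalk E x).
Variables (beta : forall x, mstalk E x -> mstalk W x).

(** The cocycle [z] represents the class of the extension
    0 -> O_C -> E -> W -> 0 given by [alpha] and [beta], where [W], with
    [dW], is [omega_C]: the [sigma i] are splittings over the open sets of a
    cover, and the linear maps [W -> O_C] induced by the [sigma j - sigma i]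
    correspond to derivations by composition with [dW]. *)
Definition extension_cocycle (z : cocycle C) : Prop :=
  exists sigma : idx z -> forall x, mstalk W x -> mstalk E x,
  [/\ forall i x, cov i x -> linear (sigma i x),
      forall i m x, cov i x -> mreg m x -> mreg (fun y => sigma i y (m y)) x,
      forall i x, cov i x -> cancel (sigma i x) (beta (x := x)) &
      forall i j x a, cov i x -> cov j x ->
        sigma j x (dW a) - sigma i x (dW a) = alpha (coc i j x a)].
End Extension.

Section DoubleCurve.
Variables (C Y : scheme k) (b : mor C Y).

(** [tau] is an isomorphism from [O_C] to the line bundle [L], the ideal sheaf
    of [C] in the double curve [Y]. *)
Record ideal_iso (tau : forall x, stalk C x -> stalk Y (b x)) : Prop :=
  IdealIso {
  ideal_iso_add : forall x, zmod_morphism (tau x);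
  ideal_iso_lin : forall x a u, tau x (pb b x a * u) = a * tau x u;
  ideal_iso_inj : forall x, injective (tau x);
  ideal_iso_image : forall x a, pb b x a = 0 <-> exists u, tau x u = a;
  ideal_iso_reg : forall s x, reg s x ->
    reg_along (f := b) (fun y => tau y (s y)) x
}.

(** [q] is the point of P(H^1(C, T_C)) \cup {0} corresponding to [Y], where
    [E] is [Omega_(Y|C)] and [W] is [omega_C]. *)
Definition double_curve_point
    (E : omodule C) (dE : forall x, stalk Y (b x) -> mstalk E x)
    (W : omodule C) (dW : forall x, stalk C x -> mstalk W x)
    (q : set (H1T C)) : Prop :=
  exists (tau : forall x, stalk C x -> stalk Y (b x))
         (beta : forall x, {linear mstalk E x -> mstalk W x}) (z : cocycle C),
  [/\ ideal_iso tau, forall x a, beta x (dE x a) = dW x (pb b x a),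
      extension_cocycle dW (fun x u => dE x (tau x u)) beta z &
      q = span1 (cocl z)].
End DoubleCurve.

(** [z] is the cocycle attached to an affine open cover of [C] and to
    trivializations [phi1 i], [phi2 i] of the neighborhoods of order [p.+1] of
    [C] in [X1], [X2], corresponding to each other modulo [t ^ p] via [Phi]. *)
Definition lambda_cocycle (C X1 X2 : scheme k) (j1 : mor C X1) (j2 : mor C X2)
    (pi1 : forall x, stalk X1 x) (pi2 : forall x, stalk X2 x) (p : nat)
    (Phi : forall x, quot (pi1 (j1 x) ^+ p) -> quot (pi2 (j2 x) ^+ p))
    (z : cocycle C) : Prop :=
  exists (phi1 : idx z -> forall x,
            nbhd_stalk j1 pi1 p.+1 x -> trunc_stalk p.+1 x)
         (psi1 : idx z -> forall x,
            trunc_stalk p.+1 x -> nbhd_stalk j1 pi1 p.+1 x)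
         (phi2 : idx z -> forall x,
            nbhd_stalk j2 pi2 p.+1 x -> trunc_stalk p.+1 x)
         (psi2 : idx z -> forall x,
            trunc_stalk p.+1 x -> nbhd_stalk j2 pi2 p.+1 x),
  [/\ forall i, affine_open (cov (c := z) i),
      forall i, trivialization (cov i) (phi1 i) (psi1 i),
      forall i, trivialization (cov i) (phi2 i) (psi2 i),
      forall i x a1 a2, cov i x -> Phi x (cl _ a1) = cl _ a2 ->
        exists u, phi2 i x (cl _ a2) - phi1 i x (cl _ a1) = cl _ 'X ^+ p * u &
      forall i j x (a : stalk C x), cov i x -> cov j x ->
        phi2 i x (psi2 j x (cl _ a%:P)) - phi1 i x (psi1 j x (cl _ a%:P)) =
        cl _ 'X ^+ p * cl _ (coc i j x a)%:P].

Definition lambda_inv (C X1 X2 : scheme k) (j1 : mor C X1) (j2 : mor C X2)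
    (pi1 : forall x, stalk X1 x) (pi2 : forall x, stalk X2 x) (p : nat)
    (Phi : forall x, quot (pi1 (j1 x) ^+ p) -> quot (pi2 (j2 x) ^+ p))
    (w : H1T C) : Prop :=
  exists2 z, lambda_cocycle Phi z & w = cocl z.

End DoubleCurves.

(* Main.v *)
(** Let [pi] be the function defining the family. The stalk of [O_Y] is
    [O_X / (pi)], where [O_X] consists of the pairs [(a1, a2)] with
    [Phi a1 = a2]. If [phi1 i], [phi2 i] are trivializations of the
    neighborhoods of order [p.+1], then [phi2 i a2 - phi1 i a1 = t ^ p * D i a]
    for a derivation [D i] of [O_Y] with values in [O_C]. The ideal of [C] in
    [Y] is generated by [- (pi1 ^ p, 0)], which [D i] maps to [1], so that [D i]
    splits [0 -> O_C -> Omega_(Y|C) -> omega_C -> 0] locally; and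
    [D i a - D j a] is the value on the restriction of [a] to [C] of the cocycle
    that defines [lambda^-1]. Another isomorphism of [O_C] with the ideal
    differs from this one by an invertible global function, which is constant
    because [C] is connected, reduced and projective. *)

Require Import Defs.
From HB Require Import structures.
From mathcomp Require Import all_boot all_order all_algebra.
From mathcomp Require Import all_classical all_reals topology.
From mathcomp.real_closed Require Import complex.
From mathcomp.multinomials Require Import (canonicals) mpoly.

Set Implicit Arguments.
Unset Strict Implicit.
Unset Printing Implicit Defensive.

Import GRing.Theory.
Local Open Scope classical_set_scope.
Local Open Scope ring_scope.

Local Notation cst := Defs.cst.

(** * Ring morphisms and regular sections *)

Section ZmodMorphism.
Variables (A B : zmodType) (g : A -> B).
Hypothesis gB : zmod_morphism g.

Lemma zmod_morphism0 : g 0 = 0.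
Proof. by rewrite -(subrr 0) gB subrr. Qed.

Lemma zmod_morphismN a : g (- a) = - g a.
Proof. by rewrite -sub0r gB zmod_morphism0 sub0r. Qed.

Lemma zmod_morphismD a b : g (a + b) = g a + g b.
Proof. by rewrite -{1}[b]opprK gB zmod_morphismN opprK. Qed.
End ZmodMorphism.

Lemma rmorph_inverse (A B : pzRingType) (g : A -> B) (h : B -> A) :
  cancel g h -> cancel h g -> rmorph g -> rmorph h.
Proof.
move=> gK hK [gB [g1 gM]]; split; first by move=> u v; rewrite -{1}[u]hK -{1}[v]hK -gB gK.
by split=> [|u v]; rewrite -?g1 ?gK // -{1}[u]hK -{1}[v]hK -gM gK.
Qed.

Lemma rmorph_exp (A B : pzRingType) (g : A -> B) a n :
  rmorph g -> g (a ^+ n) = g a ^+ n.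
Proof.
by move=> [_ [g1 gM]]; elim: n => [|n IH]; rewrite ?expr0 // !exprS gM IH.
Qed.

Lemma reg_near (k : fieldType) (X : scheme k) (s s' : forall x, stalk X x) x :
  reg s x -> reg s' x -> s x = s' x -> \forall y \near x, s y = s' y.
Proof.
move=> sx s'x ss'; have : \forall y \near x, s y - s' y = 0.
  by apply: (@reg_eq0 _ _ (fun y => s y - s' y)); [exact: regB|rewrite ss' subrr].
by apply: filterS => y /eqP; rewrite subr_eq0 => /eqP.
Qed.

Lemma lift_near (k : fieldType) (C Y : scheme k) (b : mor C Y) t x :
  (exists a, pb b x a = t x) -> reg t x ->
  exists2 s, reg s (b x) & \forall y \near x, pb b y (s (b y)) = t y.
Proof.
move=> [a ax] tx; have [s sx sa] := reg_ex a; exists s => //.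
by apply: (@reg_near _ _ (fun y => pb b y (s (b y)))); [exact: pb_reg| |rewrite sa].
Qed.

Lemma eq_reg (k : fieldType) (X : lrSpace k) (s s' : forall x, stalk X x) x :
  (forall y, s y = s' y) -> reg s x -> reg s' x.
Proof. by move=> ss'; apply: reg_germ; exact: nearW. Qed.

Section RegularSums.
Variables (k : fieldType) (X : scheme k) (x : X).

Lemma reg_sum I (r : seq I) (F : I -> forall x, stalk X x) :
  (forall i, reg (F i) x) -> reg (fun y => \sum_(i <- r) F i y) x.
Proof.
move=> Fx; elim: r => [|i r IH].
  by apply: (eq_reg _ (reg_cst 0 x)) => y; rewrite big_nil rmorph0.
by apply: (eq_reg _ (regD (Fx i) IH)) => y; rewrite big_cons.
Qed.

Lemma reg_prod I (r : seq I) (F : I -> forall x, stalk X x) :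
  (forall i, reg (F i) x) -> reg (fun y => \prod_(i <- r) F i y) x.
Proof.
move=> Fx; elim: r => [|i r IH].
  by apply: (eq_reg _ (reg_cst 1 x)) => y; rewrite big_nil rmorph1.
by apply: (eq_reg _ (regM (Fx i) IH)) => y; rewrite big_cons.
Qed.

Lemma reg_exp (s : forall x, stalk X x) n :
  reg s x -> reg (fun y => s y ^+ n) x.
Proof.
move=> sx; elim: n => [|n IH].
  by apply: (eq_reg _ (reg_cst 1 x)) => y; rewrite expr0 rmorph1.
by apply: (eq_reg _ (regM sx IH)) => y; rewrite exprS.
Qed.

Lemma nonunit_sum I (r : seq I) (Q : pred I) (F : I -> stalk X x) :
  (forall i, Q i -> F i \isn't a GRing.unit) ->
  \sum_(i <- r | Q i) F i \isn't a GRing.unit.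
Proof.
move=> nF; elim/big_rec: _ => [|i y Qi yu]; first by rewrite unitr0.
by apply/negP => /stalk_local[]; apply/negP => //; exact: nF.
Qed.

End RegularSums.

(** * Global sections of a connected reduced projective scheme *)

(** Zorn's lemma gives an ideal maximal among those that contain [I] and miss the powers of [a]. It
    is prime: adjoining [x] or [y] from outside captures a power of [a], and the product of two such
    powers would lie in the ideal if [x * y] did. *)
Lemma prime_avoiding_powers (A : comNzRingType) (I : set A) (a : A) :
  is_ideal I -> (forall n, ~ I (a ^+ n)) ->
  exists P, [/\ prime_ideal P, I `<=` P & ~ P a].
Proof.
move=> Iid Ia.
pose good (J : set A) := [/\ is_ideal J, I `<=` J & forall n, ~ J (a ^+ n)].
(* [set0] is allowed because the union of an empty chain is empty. *)
pose Q (J : set A) := J = set0 \/ good J.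
have [F FQ Ftot|J [QJ Jmax]] := @Zorn_bigcup _ Q.
  have [[J0 FJ0 gJ0]|noJ] := pselect (exists2 J, F J & good J); last first.
    left; apply/seteqP; split=> // x [J FJ Jx].
    by case: (FQ _ FJ) => [J0|gJ]; [rewrite J0 in Jx|case: noJ; exists J].
  right; split=> [|x Ix|n [J FJ Jn]].
  - case: gJ0 => -[J00 _ _] _ _; split=> [|x y [J FJ Jx] [K FK Ky]|x y [J FJ Jy]].
    + by exists J0.
    + have [L FL [Lx Ly]] : exists2 L, F L & L x /\ L y.
        by case: (Ftot _ _ FJ FK) => h; [exists K|exists J] => //; split=> //; exact: h.
      exists L => //; case: (FQ _ FL) => [L0|[[_ LD _] _ _]]; first by rewrite L0 in Lx.
      exact: LD.
    + exists J => //; case: (FQ _ FJ) => [L0|[[_ _ LM] _ _]]; first by rewrite L0 in Jy.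
      exact: LM.
  - by exists J0 => //; case: gJ0 => _ + _; apply.
  - by case: (FQ _ FJ) => [L0|[_ _ /(_ n)]] //; rewrite L0 in Jn.
have gI : good I by split.
have I0 : I 0 by case: Iid.
have [Jid IJ Ja] : good J.
  case: QJ => // J0; have : J `<` I by rewrite J0; split=> // h; exact: (h _ I0).
  by move=> /Jmax; case; right.
have [J0 JD JM] := Jid.
exists J; split=> //; last by move=> Jaa; apply: (Ja 1%N); rewrite expr1.
split=> //; first exact: (Ja 0%N).
have step x : ~ J x -> exists n y, J (a ^+ n - y * x).
  (* [K] is [J + (x)]; missing all powers of [a], it would contradict the maximality of [J]. *)
  move=> Jx; pose K := [set z | exists y, J (z - y * x)].
  apply: contrapT => h; apply: (Jmax K).
    split; last by move=> KJ; apply: Jx; apply: KJ; exists 1; rewrite mul1r subrr.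
    by move=> z Jz; exists 0; rewrite mul0r subr0.
  right; split; first split.
  - by exists 0; rewrite mul0r subrr.
  - move=> y z [u Ju] [v Jv]; exists (u + v).
    by rewrite mulrDl opprD addrACA; exact: JD.
  - move=> y z [u Ju]; exists (y * u); rewrite -mulrA -mulrBr; exact: JM.
  - by move=> z /IJ Jz; exists 0; rewrite mul0r subr0.
  - by move=> n [y Jy]; apply: h; exists n, y.
move=> x y Jxy; apply: contrapT => /not_orP[/step[n [u Ju]] /step[m [v Jv]]].
apply: (Ja (n + m)%N); rewrite exprD.
have -> : a ^+ n * a ^+ m = a ^+ m * (a ^+ n - u * x) +
   (u * x * (a ^+ m - v * y) + (u * v) * (x * y)).
  rewrite !mulrBr [a ^+ m * a ^+ n]mulrC [u * x * (v * y)]mulrACA.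
  by rewrite subrK [a ^+ m * (u * x)]mulrC subrK.
by apply: (JD); [exact: JM|apply: JD; exact: JM].
Qed.

Section Affine.
Variables (k : fieldType) (X : lrSpace k) (U : set X) (A : comNzRingType).
Variable rho : A -> forall x, stalk X x.
Hypothesis rhoP : is_spec U rho.

(** A proper ideal lies in a prime, hence in the prime of a point of [U]. *)
Lemma spec_ideal_full (J : set A) : is_ideal J ->
  (forall x, U x -> exists2 a, J a & rho a x \is a GRing.unit) -> J 1.
Proof.
move=> Jid hJ; apply: contrapT => J1.
have [n|P [Pp JP _]] := @prime_avoiding_powers _ J 1 Jid; first by rewrite expr1n.
have [x Ux Px] := (spec_prime rhoP P).1 Pp.
by have [a /JP + au] := hJ x Ux; rewrite Px /= au.
Qed.

Lemma spec_nilpotent (a : A) :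
  (forall x, U x -> rho a x \isn't a GRing.unit) -> exists n, a ^+ n = 0.
Proof.
move=> ha; apply: contrapT => an.
have [||P [Pp _ Pa]] := @prime_avoiding_powers _ [set 0 : A] a.
- by split=> // [x y -> ->|x y ->]; rewrite /= ?addr0 ?mulr0.
- by move=> n /= h; apply: an; exists n.
have [x Ux Px] := (spec_prime rhoP P).1 Pp.
by apply: Pa; rewrite Px; exact: ha.
Qed.

End Affine.

(** Write [s] near [x] as a fraction with numerator [al], and let [ga] be a unit at [x] but at no
    point of [U] outside [W]. Then [al * ga] is nowhere a unit on [U], hence nilpotent, and its germ
    at [x] vanishes by reducedness. *)
Lemma reduced_section_eq0 (k : fieldType) (X : scheme k) (V : set X)
    (s : forall x, stalk X x) :
  (forall x : X, reduced (stalk X x)) -> open V -> V `<=` reg s ->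
  (forall x, V x -> s x \isn't a GRing.unit) -> forall x, V x -> s x = 0.
Proof.
move=> Xred oV sV snu x Vx.
have [U [A [rho rhoP]] Ux] := scheme_affine x.
have [al [be [beu sx]]] := spec_frac rhoP (s x) Ux.
have rhoM y : U y -> rmorph (fun a => rho a y) := spec_rmorph rhoP (x := y).
have se : \forall y \near x, s y * rho be y = rho al y.
  apply: (@reg_near _ _ (fun y => s y * rho be y)); last by rewrite sx divrK.
    by apply: regM; [exact: sV|exact: (spec_reg rhoP)].
  exact: (spec_reg rhoP).
have [W [oW Wx Wse]] : exists W, [/\ open W, W x & forall y, W y -> V y /\ s y * rho be y = rho al y].
  have : nbhs x (V `&` [set y | s y * rho be y = rho al y]).
    by apply: filterI => //; exact: open_nbhs_nbhs.
  by rewrite nbhsE => -[W [oW Wx] WV]; exists W; split=> // y /WV[].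
have [ga gau gaW] := spec_basis rhoP Ux oW Wx.
have [n nil] : exists n, (al * ga) ^+ n = 0.
  apply: (spec_nilpotent rhoP) => y Uy; have [_ [_ M]] := rhoM y Uy.
  rewrite M unitrM negb_and; have [gay|_] := boolP (rho ga y \is a _); last by rewrite orbT.
  have [Vy <-] := Wse _ (gaW _ Uy gay).
  by rewrite unitrM (negbTE (snu _ Vy)).
have [rhoB [_ rhoM']] := rhoM x Ux.
have al0 : rho al x = 0.
  apply: (mulIr gau); rewrite mul0r -rhoM'; apply: (@Xred x _ n).
  by rewrite -(rmorph_exp _ _ (rhoM x Ux)) nil; exact: (zmod_morphism0 rhoB).
by rewrite sx al0 mul0r.
Qed.

(** For a reduced [C], this is the affineness of a closed subscheme of an affine scheme. *)
Lemma closed_affine_section (k : fieldType) (C P : scheme k) (i : mor C P)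
    (U : set P) (A : comNzRingType) (rho : A -> forall y, stalk P y)
    (f : forall x, stalk C x) :
  (forall x : C, reduced (stalk C x)) -> closed_immersion i -> is_spec U rho ->
  i @^-1` U `<=` reg f ->
  exists p, forall x, U (i x) -> f x = pb i x (rho p (i x)).
Proof.
move=> Cred [iinj icl itop isurj] rhoP fU.
have rhoM y : U y -> rmorph (fun a => rho a y) := spec_rmorph rhoP (x := y).
have oV : open (i @^-1` U).
  by apply: open_comp => [x _|]; [exact: mor_cont|exact: spec_open rhoP].
have pbU q : i @^-1` U `<=` reg (fun x => pb i x (rho q (i x))).
  by move=> x Ux; apply: (pb_reg (m := i) (s := rho q)); exact: (spec_reg rhoP).
(* The ideal of denominators of [f] on [U] is contained in no prime. *)
pose J : set A := [set q | exists p, forall x, U (i x) ->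
   f x * pb i x (rho q (i x)) = pb i x (rho p (i x))].
suff [p pP] : J 1.
  exists p => x Ux; rewrite -pP //; have [_ [-> _]] := rhoM _ Ux.
  by rewrite rmorph1 mulr1.
apply: (spec_ideal_full rhoP); first split.
- by exists 0 => x /rhoM[rB _]; rewrite (zmod_morphism0 rB) rmorph0 mulr0.
- move=> q q' [p pP] [p' pP']; exists (p + p') => x Ux.
  by rewrite !(zmod_morphismD (rhoM _ Ux).1) !rmorphD mulrDr pP // pP'.
- move=> a q [p pP]; exists (a * p) => x Ux; have [_ [_ M]] := rhoM _ Ux.
  by rewrite !M !rmorphM mulrCA pP.
move=> y Uy; have [[x _ xy]|iy] := pselect (range i y).
  subst y; have [be fx] := isurj x (f x).
  have [a [b [bu beE]]] := spec_frac rhoP be Uy.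
  have se : \forall z \near x, f z * pb i z (rho b (i z)) = pb i z (rho a (i z)).
    apply: (@reg_near _ _ (fun z => f z * pb i z (rho b (i z)))); last first.
    - by rewrite -fx beE -rmorphM divrK.
    - exact: pbU.
    - by apply: regM; [exact: fU|exact: pbU].
  move: se; rewrite -nbhs_nearE nbhsE => -[W [oW Wx] Wse].
  have [V oV' WE] := itop W oW.
  have Vx : V (i x) by rewrite WE in Wx.
  have [r ru rV] := spec_basis rhoP Uy oV' Vx.
  have [_ [_ Mx]] := rhoM _ Uy.
  (* The relation [f * b = a] is known only near [x]. Times [r], it holds on the whole trace of [U],
     because the difference is nowhere a unit there. *)
  exists (b * r); last by rewrite Mx unitrM bu.
  exists (a * r) => z Uz.
  have : (f z * pb i z (rho b (i z)) - pb i z (rho a (i z))) * pb i z (rho r (i z)) = 0.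
    apply: (reduced_section_eq0 (V := i @^-1` U) (s := fun z =>
      (f z * pb i z (rho b (i z)) - pb i z (rho a (i z))) * pb i z (rho r (i z)))) => //.
    - move=> t Ut; apply: regM; last exact: pbU.
      by apply: regB; [apply: regM; [exact: fU|]|]; exact: pbU.
    - move=> t Ut; have [rt|nrt] := boolP (rho r (i t) \is a GRing.unit).
        by rewrite Wse ?subrr ?mul0r ?unitr0 // WE; exact: rV.
      rewrite unitrM negb_and; apply/orP; right; apply: contra nrt; exact: pb_local.
  have [_ [_ M]] := rhoM _ Uz.
  by rewrite mulrBl => /eqP; rewrite subr_eq0 !M !rmorphM mulrA => /eqP.
(* Off the closed image, the denominator is a function [r] that is a unit at no point of the image,
   so that it restricts to [0] on [C]. *)
have [r ru rV] := spec_basis rhoP Uy (closed_openC icl) iy.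
exists r => //; exists 0 => x Ux.
rewrite (zmod_morphism0 (rhoM _ Ux).1) rmorph0.
rewrite (reduced_section_eq0 (V := i @^-1` U) (s := fun z => pb i z (rho r (i z)))) ?mulr0 //.
move=> z Uz; apply/negP => /pb_local rz; apply: (rV _ Uz rz); by exists z.
Qed.

(** Determinant trick: the value at [f] is the determinant of [f - A], and the adjugate matrix is
    applied to [(f - A) v = 0]. *)
Lemma char_poly_annihilates (k : fieldType) (B : comNzRingType)
    (c : {rmorphism k -> B}) (n : nat) (A : 'M[k]_n) (f : B) (v : 'cV[B]_n) :
  f *: v = map_mx c A *m v -> (map_poly c (char_poly A)).[f] *: v = 0.
Proof.
move=> fv.
have -> : (map_poly c (char_poly A)).[f] = \det (f%:M - map_mx c A).
  rewrite -[_.[f]]/((horner_eval f \o map_poly c) (char_poly A)) -det_map_mx.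
  congr (\det _); apply/matrixP => i j.
  rewrite !mxE /= /horner_eval rmorphB /= hornerD hornerN.
  rewrite map_polyC hornerC; congr (_ - _).
  by case: (i == j); rewrite ?mulr1n ?mulr0n ?map_polyX ?hornerX ?rmorph0 ?horner0.
rewrite -mul_scalar_mx -mul_adj_mx -mulmxA mulmxBl mul_scalar_mx fv.
by rewrite subrr mulmx0.
Qed.

(** * Integrality over [k] of global functions on a closed subscheme of projective space *)

Section ProjectiveSections.
Variables (k : fieldType) (C : scheme k).
Hypothesis Cred : forall x : C, reduced (stalk C x).
Variable f : forall x, stalk C x.
Hypothesis freg : forall x, reg f x.

(** [C] as a closed subscheme of the projective [n]-space: [v j l] is the
    function [x_l / x_j] on the chart [V j], whose sections are polynomials in
    these functions. *)
Variables (n : nat) (V : 'I_n.+1 -> set C).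
Variable v : 'I_n.+1 -> 'I_n.+1 -> forall x, stalk C x.
Hypothesis Vopen : forall j, open (V j).
Hypothesis Vfull : forall x, exists j, V j x.
Hypothesis vreg : forall j l, V j `<=` reg (v j l).
Hypothesis v1 : forall j x, V j x -> v j j x = 1.
Hypothesis vunit : forall i j x, V i x -> (V j x <-> v i j x \is a GRing.unit).
Hypothesis vM : forall i j l x, V i x -> V j x -> v i l x = v i j x * v j l x.
Variable P : 'I_n.+1 -> mpoly.mpoly n k.
Hypothesis fP : forall j x, V j x ->
  f x = mpoly.mmap (cst x) (fun l => v j (lift j l) x) (P j).

(** As [d] exceeds the degrees of all the [P j], a monomial of degree [N] is divisible by some
    [x_i ^ d]; its product with [P i] has no denominator and is still divisible by [x_i]. *)
Let d := (\max_j \max_(mu <- mpoly.msupp (P j)) mpoly.mdeg mu).+1.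
Let N := (n.+1 * d)%N.

Let monom := {m : {ffun 'I_n.+1 -> 'I_N.+1} | (\sum_l m l == N)%N}.

(** The homogeneous monomial with exponents [m], divided by the power of [x_j] of the same
    degree. *)
Let ev (j : 'I_n.+1) (m : 'I_n.+1 -> nat) (x : C) : stalk C x :=
  \prod_l v j l x ^+ m l.

Let ev_chart i j m x : (\sum_l m l)%N = N -> V i x -> V j x ->
  ev j m x = v j i x ^+ N * ev i m x.
Proof.
move=> mN ix jx; rewrite -mN -prodrXr -big_split /=; apply: eq_bigr => l _.
by rewrite -exprMn -vM.
Qed.

Let ev_nonunit i j m x : (0 < m i)%N -> V j x -> ~ V i x ->
  ev j m x \isn't a GRing.unit.
Proof.
move=> mi jx ix; rewrite /ev (bigD1 i) //= unitrM negb_and; apply/orP; left.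
by rewrite unitrX_pos //; apply/negP => /(vunit _ jx).
Qed.

(** Exponents of the product of the monomial [m] with [mu] evaluated at the quotients [x_l / x_i].
    The subtraction is truncated, hence the bound in [shift_sum]. *)
Let shift i (m : 'I_n.+1 -> nat) (mu : mpoly.multinom n) (l : 'I_n.+1) : nat :=
  if unlift i l is Some l' then (m l + mpoly.fun_of_multinom mu l')%N
  else (m l - mpoly.mdeg mu)%N.

Let shift_sum i m mu : (mpoly.mdeg mu <= m i)%N ->
  (\sum_l shift i m mu l = \sum_l m l)%N.
Proof.
move=> mui; rewrite (bigD1_ord i) //= [RHS](bigD1_ord i) //=.
rewrite {1}/shift unlift_none.
under eq_bigr => l _ do rewrite /shift liftK.
by rewrite big_split /= -mpoly.mdegE [X in (_ + X)%N]addnC addnA subnK.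
Qed.

Let ev_shift i m mu x : V i x ->
  ev i (shift i m mu) x = ev i m x * mpoly.mmap1 (fun l => v i (lift i l) x) mu.
Proof.
move=> ix; rewrite /ev (bigD1_ord i) //= [in RHS](bigD1_ord i) //= v1 // !expr1n !mul1r.
rewrite /mpoly.mmap1 -big_split /=; apply: eq_bigr => l _.
by rewrite /shift liftK exprD.
Qed.

Let expo (m : monom) (l : 'I_n.+1) : nat := val m l.

Let expo_sum m : (\sum_l expo m l = N)%N.
Proof. exact/eqP/(valP m). Qed.

(* Some variable [x_i] divides the monomial [m] to the power at least [d]; so
   [f m] is a combination of monomials on the chart [V i], and all the terms of
   this equality vanish outside of it. *)
Let f_ev (m : monom) : exists s : seq (k * monom), forall j x, V j x ->
  f x * ev j (expo m) x = \sum_(e <- s) cst x e.1 * ev j (expo e.2) x.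
Proof.
have [i di] : exists i, (d <= expo m i)%N.
  apply: contrapT => h; have : (\sum_l expo m l < N)%N.
    have le l : (expo m l < d)%N by rewrite ltnNge; apply/negP => ?; apply: h; exists l.
    have Nd : (\sum_(l < n.+1) d = N)%N by rewrite sum_nat_const card_ord.
    rewrite -Nd; apply: (@leq_ltn_trans (\sum_(l < n.+1) d.-1)).
      by apply: leq_sum => l _; rewrite -ltnS.
    by rewrite !sum_nat_const card_ord ltn_mul2l /= ltnSn.
  by rewrite expo_sum ltnn.
have mdegP mu : mu \in mpoly.msupp (P i) -> (mpoly.mdeg mu < d)%N.
  move=> muP; rewrite ltnS; apply: leq_trans (leq_bigmax i).
  exact: (leq_bigmax_seq (F := fun mu => mpoly.mdeg mu)).
(* [insubd] falls back on [m] if the degree is not [N]; [mkE] excludes this for [mu] in the support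
   of [P i]. *)
pose mk mu : monom := insubd m [ffun l => inord (shift i (expo m) mu l)].
have mkE mu : mu \in mpoly.msupp (P i) ->
    forall l, expo (mk mu) l = shift i (expo m) mu l.
  move=> muP; have sN : (\sum_l shift i (expo m) mu l = N)%N.
    rewrite shift_sum; first exact: expo_sum.
    exact: leq_trans (ltnW (mdegP _ muP)) di.
  have le l : (shift i (expo m) mu l < N.+1)%N.
    by rewrite ltnS -[leqRHS]sN (bigD1 l) //= leq_addr.
  move=> l; rewrite /expo /mk val_insubd.
  case: ifP => [_|/eqP[]]; first by rewrite ffunE inordK.
  by rewrite -[RHS]sN; apply: eq_bigr => l' _; rewrite ffunE inordK.
exists [seq (mpoly.mcoeff mu (P i), mk mu) | mu <- mpoly.msupp (P i)].
move=> j x jx; rewrite big_map /=.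
have mkev t j' : V j' t -> forall mu, mu \in mpoly.msupp (P i) ->
    ev j' (expo (mk mu)) t = ev j' (shift i (expo m) mu) t.
  by move=> _ mu muP; apply: eq_bigr => l _; rewrite mkE.
apply/eqP; rewrite -subr_eq0; apply/eqP.
apply: (reduced_section_eq0 (V := V j) (s := fun x => f x * ev j (expo m) x -
  \sum_(mu <- mpoly.msupp (P i)) cst x (mpoly.mcoeff mu (P i)) * ev j (expo (mk mu)) x)) => //.
  have evreg m' : V j `<=` reg (ev j m').
    by move=> y jy; apply: reg_prod => l; apply: reg_exp; exact: vreg.
  move=> y jy; apply: regB; first by apply: regM; [exact: freg|exact: evreg].
  by apply: reg_sum => mu; apply: regM; [exact: reg_cst|exact: evreg].
move=> t jt; have [it|it] := pselect (V i t).
  suff -> : f t * ev j (expo m) t = \sum_(mu <- mpoly.msupp (P i))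
      cst t (mpoly.mcoeff mu (P i)) * ev j (expo (mk mu)) t.
    by rewrite subrr unitr0.
  rewrite (ev_chart (expo_sum m) it jt).
  rewrite (fP it) /mpoly.mmap mulr_suml.
  rewrite !big_seq; apply: eq_bigr => mu muP.
  rewrite (ev_chart (expo_sum (mk mu)) it jt).
  rewrite (mkev t) // ev_shift // -!mulrA; congr (_ * _).
  by rewrite [LHS]mulrC mulrA.
have mi : (0 < expo m i)%N by apply: leq_trans di.
apply/negP => /(@stalk_local _ C t)[|].
  by rewrite unitrM (negbTE (ev_nonunit mi jt it)) andbF.
rewrite unitrN; apply/negP; rewrite big_seq; apply: nonunit_sum => mu muP.
rewrite unitrM negb_and; apply/orP; right; apply: (ev_nonunit _ jt it).
by rewrite mkE // /shift unlift_none subn_gt0 (leq_trans (mdegP _ muP)).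
Qed.

(** Multiplication by [f] acts on the monomials of degree [N] through a matrix over [k], the same on
    all charts and at all points; its characteristic polynomial annihilates [f]. *)
Lemma global_section_integral :
  exists2 q : {poly k}, q \is monic & forall x, (map_poly (cst x) q).[f x] = 0.
Proof.
have row (m : monom) : exists a : monom -> k, forall j x, V j x ->
    f x * ev j (expo m) x = \sum_m' cst x (a m') * ev j (expo m') x.
  have [s sP] := f_ev m.
  exists (fun m' => \sum_(e <- s | e.2 == m') e.1) => j x jx; rewrite sP //.
  under [RHS]eq_bigr => m' _ do rewrite rmorph_sum mulr_suml /=.
  rewrite (exchange_big_dep xpredT) //=; apply: eq_bigr => e _.
  by rewrite (big_pred1 e.2) // => m'; rewrite eq_sym.
have [a aP] := choice row.
pose A : 'M[k]_#|{: monom}| := \matrix_(r, l) a (enum_val r) (enum_val l).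
exists (char_poly A); first exact: char_poly_monic.
move=> x; have [j jx] := Vfull x.
pose w : 'cV[stalk C x]_#|{: monom}| := \col_r ev j (expo (enum_val r)) x.
have : f x *: w = map_mx (cst x) A *m w.
  apply/colP => r; rewrite !mxE aP //.
  rewrite (reindex (@enum_val _ {: monom})) /=; last exact/onW_bij/enum_val_bij.
  by apply: eq_bigr => l _; rewrite !mxE.
move=> /char_poly_annihilates/colP w0.
(* The monomial [x_j ^ N] is [1] on [V j], so its row of [w0] is the equation for [f]. *)
pose m0 : {ffun 'I_n.+1 -> 'I_N.+1} := [ffun l => if l == j then ord_max else ord0].
have m0N : (\sum_l m0 l == N)%N.
  rewrite (bigD1 j) //= ffunE eqxx big1 ?addn0 //= => l /negbTE lj.
  by rewrite ffunE lj.
have := w0 (enum_rank (Sub m0 m0N : monom)); rewrite !mxE enum_rankK.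
suff -> : ev j (expo (Sub m0 m0N)) x = 1 by rewrite mulr1.
rewrite /ev big1 // => l _; rewrite /expo SubK ffunE.
by case: eqP => [->|_]; rewrite ?v1 ?expr1n ?expr0.
Qed.

End ProjectiveSections.

(** [q] splits into linear factors. Distinct constants differ by units, so in a local ring [a - c]
    is a nonunit for at most one [c]. There is one since the product is [0], and a power of this
    factor vanishes. *)
Lemma reduced_local_root (k : closedFieldType) (C : scheme k) (x : C)
    (q : {poly k}) (a : stalk C x) : reduced (stalk C x) ->
  q \is monic -> (map_poly (cst x) q).[a] = 0 -> exists c, a = cst x c.
Proof.
move=> Cred qm; have [r ->] := closed_field_poly_normal q.
rewrite (eqP qm) scale1r rmorph_prod horner_prod.
have fE z : (map_poly (cst x) ('X - z%:P)).[a] = a - cst x z.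
  by rewrite rmorphB /= map_polyX map_polyC hornerXsubC.
under eq_bigr => z _ do rewrite fE.
have [[c cr ac]|nu] := pselect (exists2 c, c \in r & a - cst x c \isn't a GRing.unit).
  have unit_neq z : z != c -> a - cst x z \is a GRing.unit.
    move=> zc; have : (a - cst x z) + (cst x c - a) \is a GRing.unit.
      rewrite addrC addrA subrK -rmorphB rmorph_unit // unitfE subr_eq0.
      by rewrite eq_sym.
    by case/stalk_local => //; rewrite -opprB unitrN (negbTE ac).
  have [m [w wu ->]] : exists m, exists2 w, w \is a GRing.unit &
      \prod_(z <- r) (a - cst x z) = w * (a - cst x c) ^+ m.
    elim: r {cr} => [|z r [m [w wu IH]]].
      by exists 0%N, 1; rewrite ?unitr1 // big_nil mulr1.
    rewrite big_cons IH; have [->|zc] := eqVneq z c.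
      by exists m.+1, w => //; rewrite mulrCA -exprS.
    by exists m, ((a - cst x z) * w); rewrite ?mulrA // unitrM unit_neq.
  rewrite -(mulr0 w) => /(mulrI wu)/Cred/eqP.
  by rewrite subr_eq0 => /eqP ->; exists c.
have : \prod_(z <- r) (a - cst x z) \is a GRing.unit.
  rewrite big_seq; apply: rpred_prod => z zr.
  by apply: contrapT => /negP zu; apply: nu; exists z.
by move=> + p0; rewrite p0 unitr0.
Qed.

(** A monic equation over [k] makes every germ of [f] a constant. The loci where this constant is
    fixed are open and disjoint, hence also closed, and connectedness leaves only one. *)
Lemma global_section_constant (k : closedFieldType) (C : scheme k)
    (f : forall x, stalk C x) :
  (forall x : C, reduced (stalk C x)) -> [set: C] !=set0 ->
  connected [set: C] -> projective C -> (forall x, reg f x) ->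
  exists c, forall x, f x = cst x c.
Proof.
move=> Cred [x0 _] Cconn [n [P [hP [i [[hPreg hPM hPc] Pproj iimm hc]]]]] freg.
have [U [u [Ufull Uspec u1 uunit uM]]] := Pproj.
have ureg j l : U j `<=` reg (u j l).
  move=> y jy; case: (unliftP j l) => [l' ->|->]; last first.
    apply: (reg_germ _ (reg_cst 1 y)).
    move: (spec_open (Uspec j)); rewrite openE => /(_ y jy).
    rewrite /interior /=; apply: filterS => z jz.
    by rewrite u1 // rmorph1.
  have := spec_reg (Uspec j) (mpoly.mpolyX k (mpoly.mnm1 l')) jy.
  apply: eq_reg => z; rewrite /mpoly.mmap mpoly.msuppX big_seq1.
  have [_ [hP1 _]] := hPM z.
  by rewrite mpoly.mcoeffX eqxx hP1 mul1r mpoly.mmap1U.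
have pbU x (a : stalk P (i x)) : (a \is a GRing.unit) <-> (pb i x a \is a GRing.unit).
  by split=> [au|/pb_local //]; rewrite rmorph_unit.
have /choice[p pP] j : exists p : mpoly.mpoly n k, forall x, U j (i x) ->
    f x = mpoly.mmap (cst x) (fun l => pb i x (u j (lift j l) (i x))) p.
  have [p pP] := closed_affine_section Cred iimm (Uspec j) (fun x _ => freg x).
  exists p => x jx; rewrite pP // /mpoly.mmap rmorph_sum; apply: eq_bigr => m _.
  rewrite rmorphM hPc pb_cst /mpoly.mmap1 rmorph_prod; congr (_ * _).
  by apply: eq_bigr => l _; rewrite rmorphXn.
have [q qm qP] : exists2 q : {poly k}, q \is monic &
    forall x, (map_poly (cst x) q).[f x] = 0.
  apply: (@global_section_integral _ C Cred f freg n (fun j => i @^-1` U j)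
    (fun j l x => pb i x (u j l (i x))) _ _ _ _ _ _ p pP).
  - move=> j; apply: open_comp => [x _|]; first exact: mor_cont.
    exact: spec_open (Uspec j).
  - by move=> x; exact: Ufull.
  - by move=> j l x jx; apply: pb_reg; exact: ureg.
  - by move=> j x jx; rewrite u1 // rmorph1.
  - by move=> j l x jx; rewrite -pbU; exact: uunit.
  - by move=> j l m x jx lx; rewrite (uM j l) // rmorphM.
have fc x : exists c, f x = cst x c := reduced_local_root (Cred x) qm (qP x).
have oc c : open [set x | f x = cst x c].
  rewrite openE => x /= fx.
  exact: (reg_near (freg x) (reg_cst c x) fx).
have [c fx0] := fc x0; exists c.
suff : [set x | f x = cst x c] = setT by move=> /seteqP[_ h] x; apply: h.
apply: Cconn; first by exists x0.
- by exists [set x | f x = cst x c]; rewrite ?setTI.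
- exists [set x | f x = cst x c]; rewrite ?setTI //.
  have -> : [set x | f x = cst x c] = ~` (\bigcup_(c' in ~` [set c]) [set x | f x = cst x c']).
    apply/seteqP; split=> x /=.
      by move=> fx [c' /= cc']; rewrite /= fx => /fmorph_inj /esym.
    move=> h; have [c' fx] := fc x; have [<- //|cc'] := pselect (c' = c).
    by case: h; exists c'.
  by apply/open_closedC/bigcup_open => c' _.
Qed.

(** * Sheaves of differentials *)

Section Span.
Variables (A : pzRingType) (M : lmodType A) (T : Type) (d : T -> M).

Definition span_pred : {pred M} :=
  fun e => `[< exists r : seq (A * T), e = \sum_(c <- r) c.1 *: d c.2 >].

Lemma span_submod_closed : submod_closed span_pred.
Proof.
split; first by apply/asboolP; exists [::]; rewrite big_nil.
move=> a u v /asboolP[r ->] /asboolP[r' ->]; apply/asboolP.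
exists ([seq (a * c.1, c.2) | c <- r] ++ r').
rewrite big_cat big_map scaler_sumr; congr (_ + _).
by apply: eq_bigr => c _; rewrite scalerA.
Qed.

HB.instance Definition _ :=
  GRing.isSubmodClosed.Build A M span_pred span_submod_closed.

(** Packed as a module to be a target in the universal property of differentials. *)
Record span_mod := SpanMod { span_val :> M; _ : span_val \in span_pred }.

HB.instance Definition _ := [isSub for span_val].
HB.instance Definition _ := [Choice of span_mod by <:].
HB.instance Definition _ := [SubChoice_isSubLmodule of span_mod by <:].
End Span.

Section Omodule.
Variables (k : fieldType) (X : scheme k) (E : omodule X).
Implicit Types m : forall x, mstalk E x.

Lemma mreg0 x : mreg (fun y => 0 : mstalk E y) x.
Proof.
have [m mx _] := mreg_ex (0 : mstalk E x).
by apply: (mreg_germ _ (mregB mx mx)); apply: nearW => y; rewrite subrr.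
Qed.

Lemma mregD m m' x : mreg m x -> mreg m' x -> mreg (fun y => m y + m' y) x.
Proof.
move=> mx m'x; apply: (mreg_germ _ (mregB mx (mregB (mreg0 x) m'x))).
by apply: nearW => y; rewrite sub0r opprK.
Qed.

Lemma mreg_sum I (r : seq I) (F : I -> forall x, mstalk E x) x :
  (forall i, mreg (F i) x) -> mreg (fun y => \sum_(i <- r) F i y) x.
Proof.
move=> Fx; elim: r => [|i r IH].
  by apply: (mreg_germ _ (mreg0 x)); apply: nearW => y; rewrite big_nil.
by apply: (mreg_germ _ (mregD (Fx i) IH)); apply: nearW => y; rewrite big_cons.
Qed.

Lemma mreg_near m m' x :
  mreg m x -> mreg m' x -> m x = m' x -> \forall y \near x, m y = m' y.
Proof.
move=> mx m'x e; have : \forall y \near x, m y - m' y = 0.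
  by apply: (@mreg_eq0 _ _ _ (fun y => m y - m' y)) (mregB mx m'x) _; rewrite e subrr.
by apply: filterS => y /eqP; rewrite subr_eq0 => /eqP.
Qed.
End Omodule.

Section StructureSheaf.
Variables (k : fieldType) (X : scheme k).

Program Definition structure_omodule : omodule X :=
  @OModule k X (fun x => (stalk X x)^o) (@reg k X) _ _ _ _ _ _.
Next Obligation. exact: reg_open. Qed.
Next Obligation. exact: reg_germ. Qed.
Next Obligation. exact: regB. Qed.
Next Obligation. exact: regM. Qed.
Next Obligation. exact: reg_ex. Qed.
Next Obligation. exact: reg_eq0. Qed.
End StructureSheaf.

Section Differentials.
Variables (k : fieldType) (X Y : scheme k) (f : mor X Y) (E : omodule X).
Variable d : forall x, stalk Y (f x) -> mstalk E x.
Hypothesis dP : is_differentials d.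

(** [d] factors through the submodule spanned by its values; by uniqueness in the universal
    property, the resulting endomorphism of the stalk is the identity. *)
Lemma differentials_span x (e : mstalk E x) :
  exists r : seq (stalk X x * stalk Y (f x)), e = \sum_(c <- r) c.1 *: d c.2.
Proof.
have [dder duniv _] := dP.
have dspan a : d (x := x) a \in span_pred (d (x := x)).
  by apply/asboolP; exists [:: (1, a)]; rewrite big_seq1 scale1r.
pose g a : span_mod (d (x := x)) := SpanMod (dspan a).
have gder : derivation_along g.
  have [dB d0 dM] := dder x; split.
  - by move=> a b; apply: val_inj; rewrite /= dB.
  - by move=> c; apply: val_inj; rewrite /= d0.
  - by move=> a b; apply: val_inj; rewrite /= dM.
have [l [lg _]] := duniv x _ g gder.
have [id' [_ uniq]] := duniv x _ (d (x := x)) (dder x).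
have e1 := uniq (\val \o l)%FUN (fun a => congr1 val (lg a)).
have e2 := uniq idfun (fun a => erefl).
have /asboolP := valP (l e).
suff -> : val (l e) = e by [].
by rewrite -[LHS]/((val \o l) e) e1 -e2.
Qed.

Lemma differentials_ext x (M : lmodType (stalk X x)) (l l' : mstalk E x -> M) :
  linear l -> linear l' -> (forall a, l (d a) = l' (d a)) -> l =1 l'.
Proof.
move=> ll ll' h e; have [r ->] := differentials_span e.
elim: r => [|c r IH].
  rewrite big_nil (zmod_morphism0 (GRing.zmod_morphism_linear ll)).
  by rewrite (zmod_morphism0 (GRing.zmod_morphism_linear ll')).
by rewrite big_cons ll ll' h IH.
Qed.

Lemma mreg_d t x : reg t (f x) -> mreg (fun y => d (t (f y))) x.
Proof.
by move=> tx; case: dP => _ _; apply; exists t => //; exact: nearW.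
Qed.

(** Near [x] a section is a finite combination of elements [d t] with regular coefficients. *)
Lemma mreg_linear (F : omodule X) (l : forall x, mstalk E x -> mstalk F x)
    (U : set X) m x :
  open U -> U x -> (forall y, U y -> linear (l y)) ->
  (forall t, reg t (f x) -> mreg (fun y => l y (d (t (f y)))) x) ->
  mreg m x -> mreg (fun y => l y (m y)) x.
Proof.
move=> oU Ux llin ld mx.
have [r mE] := differentials_span (m x).
have /choice[A AP] (a : stalk X x) : exists s, reg s x /\ s x = a.
  by have [s sx sa] := reg_ex a; exists s.
have /choice[B BP] (a : stalk Y (f x)) : exists s, reg s (f x) /\ s (f x) = a.
  by have [s sx sa] := reg_ex a; exists s.
have near_m : \forall y \near x, U y /\
    m y = \sum_(c <- r) A c.1 y *: d (B c.2 (f y)).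
  apply: filterI; first exact: open_nbhs_nbhs.
  apply: mreg_near => //.
    apply: mreg_sum => c; apply: mregZ; first by case: (AP c.1).
    by apply: mreg_d; case: (BP c.2).
  by rewrite mE; apply: eq_bigr => c _; case: (AP c.1) => _ ->; case: (BP c.2) => _ ->.
have : mreg (fun y => \sum_(c <- r) A c.1 y *: l y (d (B c.2 (f y)))) x.
  apply: mreg_sum => c; apply: mregZ; first by case: (AP c.1).
  by apply: ld; case: (BP c.2).
apply: mreg_germ; apply: filterS near_m => y [Uy ->].
have ly := llin y Uy.
elim: r {mE} => [|c r IH].
  by rewrite !big_nil (zmod_morphism0 (GRing.zmod_morphism_linear ly)).
by rewrite !big_cons ly IH.
Qed.

End Differentials.

(** * Extensions split by local derivations *)

Section IdealIso.
Variables (k : fieldType) (C Y : scheme k) (b : mor C Y).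
Hypothesis bsurj : forall x (u : stalk C x), exists a, pb b x a = u.
Variables (E : omodule C) (dE : forall x, stalk Y (b x) -> mstalk E x).
Hypothesis hE : is_differentials dE.
Variable tau : forall x, stalk C x -> stalk Y (b x).
Hypothesis htau : ideal_iso tau.

Lemma ideal_iso_pb x u : pb b x (tau u) = 0.
Proof. by apply/(ideal_iso_image htau); exists u. Qed.

Lemma ideal_iso_zmod x : zmod_morphism (fun u => dE (tau (x := x) u)).
Proof.
by have [/(_ x)[dB _ _] _ _] := hE; move=> u v; rewrite (ideal_iso_add htau) dB.
Qed.

(** In the Leibniz rule for a lift of [a], the other term has as coefficient the restriction to [C]
    of an element of the ideal. *)
Lemma ideal_iso_scale x (a u : stalk C x) : dE (tau (a * u)) = a *: dE (tau u).
Proof.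
have [/(_ x)[_ _ dM] _ _] := hE; have [a' <-] := bsurj a.
by rewrite (ideal_iso_lin htau) dM ideal_iso_pb scale0r addr0.
Qed.

Lemma ideal_iso_mreg s x : reg s x -> mreg (fun y => dE (tau (s y))) x.
Proof. by move=> sx; case: hE => _ _; apply; exact: (ideal_iso_reg htau). Qed.
End IdealIso.

(** The function [v] with [tau v = tau' 1] is regular, hence a constant [c], nonzero because [tau']
    is injective. *)
Lemma ideal_iso_ratio (k : fieldType) (C Y : scheme k) (b : mor C Y)
    (tau tau' : forall x, stalk C x -> stalk Y (b x)) :
  (forall x (u : stalk C x), exists a, pb b x a = u) -> [set: C] !=set0 ->
  (forall f : forall x, stalk C x, (forall x, reg f x) ->
     exists c, forall x, f x = cst x c) ->
  ideal_iso tau -> ideal_iso tau' ->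
  exists2 c, c != 0 & forall x u, tau' x u = tau x (cst x c * u).
Proof.
move=> bsurj [x0 _] const htau htau'.
pose v x : stalk C x := projT1 (cid ((ideal_iso_image htau _).1 (ideal_iso_pb htau' (1 : stalk C x)))).
have vE x : tau x (v x) = tau' x 1 :=
  projT2 (cid ((ideal_iso_image htau _).1 (ideal_iso_pb htau' (1 : stalk C x)))).
have [|c vc] := const v.
  move=> x; have [s sx sv] := reg_ex (v x).
  have [t tx tE] := ideal_iso_reg htau sx.
  have [t' t'x tE'] : reg_along (f := b) (fun y => tau' y 1) x.
    have [t' t'x tE'] := ideal_iso_reg htau' (reg_cst 1 x).
    by exists t' => //; apply: filterS tE' => y; rewrite rmorph1.
  (* [t] and [t'] represent [tau s] and [tau' 1]. Once they agree near [b x], injectivity of [tau]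
     gives [s = v] near [x]. *)
  have tt' : \forall y \near b x, t y = t' y.
    apply: reg_near => //.
    by rewrite -(nbhs_singleton tE) -(nbhs_singleton tE') sv vE.
  apply: (reg_germ _ sx).
  have btt' := mor_cont tt'.
  near=> y; apply: (ideal_iso_inj htau); rewrite vE.
  by rewrite (near tE y) // (near tE' y) //; near: y.
have tauE x u : tau' x u = tau x (cst x c * u).
  have [a <-] := bsurj x u; rewrite -[pb b x a]mulr1 (ideal_iso_lin htau') -vE.
  by rewrite mulr1 [cst x c * _]mulrC (ideal_iso_lin htau) vc.
exists c => //; apply/eqP => c0; have := oner_neq0 (stalk C x0).
rewrite -[X in X != _](_ : 0 = 1) ?eqxx //; apply: (ideal_iso_inj htau').
by rewrite !tauE c0 rmorph0 !mul0r.
Unshelve. all: by end_near.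
Qed.

(* [D i] plays the role of a local retraction of [Y] onto [C]: it induces a
   splitting of the extension over [cov i]. *)
Section Retractions.
Variables (k : fieldType) (C Y : scheme k) (b : mor C Y).
Hypothesis bsurj : forall x (u : stalk C x), exists a, pb b x a = u.
Variables (E : omodule C) (dE : forall x, stalk Y (b x) -> mstalk E x).
Hypothesis hE : is_differentials dE.
Variables (W : omodule C) (dW : forall x, stalk C x -> mstalk W x).
Hypothesis hW : is_differentials (f := idmor C) dW.
Variable tau : forall x, stalk C x -> stalk Y (b x).
Hypothesis htau : ideal_iso tau.
Variable z : cocycle C.
Variable D : idx z -> forall x, stalk Y (b x) -> (stalk C x)^o.
Hypothesis Dder : forall i x, cov i x -> derivation_along (D i (x := x)).
Hypothesis Dtau : forall i x u, cov i x -> D i (tau u) = u :> stalk C x.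
Hypothesis Dreg : forall i t x, cov i x -> reg t (b x) ->
  reg (fun y => D i (t (b y))) x.
Hypothesis Dcoc : forall i j x (a : stalk Y (b x)), cov i x -> cov j x ->
  D i a - D j a = coc i j x (pb b x a).

Let theta x (u : stalk C x) := dE (tau u).

Let thetaB x : zmod_morphism (@theta x).
Proof. exact: (ideal_iso_zmod hE htau). Qed.

Let thetaZ x a (w : (stalk C x)^o) : theta (a *: w) = a *: theta w.
Proof. exact: (ideal_iso_scale bsurj hE htau). Qed.

Let beta x : exists l : {linear mstalk E x -> mstalk W x},
  forall a, l (dE a) = dW (pb b x a).
Proof.
have [/(_ x)[dB d0 dM] _ _] := hW; have [_ /(_ x) h _] := hE.
have der : derivation_along (fun a => dW (pb b x a)).
  split=> [u v|c|u v]; first by rewrite rmorphB dB.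
    by rewrite pb_cst; exact: d0.
  by rewrite rmorphM; exact: dM.
by have [l [lP _]] := h _ _ der; exists l.
Qed.

(** The universal property turns [D i] into a linear retraction of [theta]; off [cov i] the zero map
    is a default. *)
Let retr_ex i x : exists l : mstalk E x -> (stalk C x)^o, cov i x ->
  linear l /\ forall a, l (dE a) = D i a.
Proof.
have [ix|ix] := pselect (cov i x); last by exists (fun=> 0).
have [_ /(_ x) h _] := hE; have [l [lP _]] := h _ _ (Dder ix).
by exists l => _; split=> //; exact: linearP.
Qed.

Let retr i x := projT1 (cid (retr_ex i x)).
Let retrP i x : cov i x -> linear (retr i (x := x)) /\
  forall a, retr i (dE a) = D i a := projT2 (cid (retr_ex i x)).

(** By [Dtau], [dE a - theta (D i a)] vanishes on the ideal of [C], so it depends only on the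
    restriction of [a]. It is a derivation in this restriction and factors through [W]. *)
Let split_ex i x : exists l : mstalk W x -> mstalk E x, cov i x ->
  linear l /\ forall a, l (dW (pb b x a)) = dE a - theta (D i a).
Proof.
have [ix|ix] := pselect (cov i x); last by exists (fun=> 0).
have [/(_ x)[dB d0 dM] _ _] := hE; have [_ /(_ x) h _] := hW.
have [DB D0 DM] := Dder ix.
have /choice[s sP] := bsurj (x := x).
pose g a := dE (s a) - theta (D i (s a)).
have gE a : g (pb b x a) = dE a - theta (D i a).
  have /(ideal_iso_image htau)[u uE] : pb b x (s (pb b x a) - a) = 0.
    by rewrite rmorphB sP subrr.
  have e : dE (s (pb b x a)) - dE a = theta (D i (s (pb b x a))) - theta (D i a).
    by rewrite -dB -thetaB -DB -uE Dtau.
  by apply/eqP; rewrite subr_eq -addrA addrC -subr_eq e addrC.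
suff der : derivation_along (f := idmor C) (x := x) g.
  have [l [lP _]] := h _ g der.
  by exists l => _; split=> [|a]; [exact: linearP|rewrite lP gE].
split=> [u v|c|u v] /=.
- have [u' <-] := bsurj u; have [v' <-] := bsurj v.
  by rewrite -rmorphB !gE dB DB thetaB !opprD !opprK addrACA.
- by rewrite -(pb_cst b x c) gE d0 D0 (zmod_morphism0 (@thetaB x)) subrr.
- have [u' <-] := bsurj u; have [v' <-] := bsurj v.
  rewrite -rmorphM !gE dM DM (zmod_morphismD (@thetaB x)) !thetaZ.
  by rewrite opprD addrACA -!scalerBr.
Qed.

Let split i x := projT1 (cid (split_ex i x)).
Let splitP i x : cov i x -> linear (split i (x := x)) /\
  forall a, split i (dW (pb b x a)) = dE a - theta (D i a) :=
  projT2 (cid (split_ex i x)).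

Let theta_retr i x u : cov i x -> retr i (theta u) = u :> stalk C x.
Proof. by move=> ix; have [_ ->] := retrP ix; exact: Dtau. Qed.

Let theta_inj x : injective (@theta x).
Proof.
have [i ix] := cov_full _ _ z x => u v uv.
by rewrite -(theta_retr u ix) -(theta_retr v ix) uv.
Qed.

Let split_reg i m x : cov i x -> mreg m x -> mreg (fun y => split i (m y)) x.
Proof.
move=> ix; apply: (mreg_linear hW (cov_open _ _ z i)) => // [y iy|t tx].
  by have [] := splitP iy.
have [s sx st] := lift_near (bsurj (t x)) tx.
have := mregB (mreg_d hE sx) (ideal_iso_mreg hE htau (Dreg ix sx)).
apply: mreg_germ.
have iN : \forall y \near x, cov i y by apply: open_nbhs_nbhs; split=> //; exact: cov_open.
by apply: filterS2 iN st => y iy <-; have [_ ->] := splitP iy.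
Qed.

Let retr_reg i m x : cov i x -> mreg m x -> reg (fun y => retr i (m y)) x.
Proof.
move=> ix; apply: (mreg_linear (F := structure_omodule C) hE (cov_open _ _ z i)) => // [y iy|t tx].
  by have [] := retrP iy.
have iN : \forall y \near x, cov i y by apply: open_nbhs_nbhs; split=> //; exact: cov_open.
apply: (@reg_germ _ _ _ _ _ _ (Dreg ix tx)).
by apply: filterS iN => y iy; have [_ ->] := retrP iy.
Qed.

Let decomp i x (l : {linear mstalk E x -> mstalk W x}) : cov i x ->
  (forall a, l (dE a) = dW (pb b x a)) ->
  forall e, e = split i (l e) + theta (retr i e).
Proof.
move=> ix lP; have [slin sP] := splitP ix; have [rlin rP] := retrP ix.
apply: (differentials_ext hE (l := idfun) (l' := fun e => split i (l e) + theta (retr i e))) => //.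
  move=> a u v /=; rewrite linearP slin rlin.
  by rewrite (zmod_morphismD (@thetaB x)) thetaZ scalerDr addrACA.
by move=> a /=; rewrite lP sP rP subrK.
Qed.

(** The indices are exchanged because [D i] enters [split i] with a minus sign. *)
Let split_coc i j x a : cov i x -> cov j x ->
  split j (dW a) - split i (dW a) = theta (coc i j x a).
Proof.
move=> ix jx; have [a' <-] := bsurj a; have [_ siP] := splitP ix.
have [_ sjP] := splitP jx; rewrite siP sjP opprB addrC addrA subrK -thetaB.
by rewrite -(Dcoc _ ix jx).
Qed.

Lemma retraction_extension_cocycle : exists beta' : forall x, {linear mstalk E x -> mstalk W x},
  (forall x a, beta' x (dE a) = dW (pb b x a)) /\
  extension_cocycle dW (fun x u => dE (tau u)) beta' z.
Proof.
exists (fun x => projT1 (cid (beta x))).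
have betaP x a : projT1 (cid (beta x)) (dE a) = dW (pb b x a) := projT2 (cid (beta x)) a.
split=> //; exists split; split.
- by move=> i x ix; have [] := splitP ix.
- exact: split_reg.
- move=> i x ix; have [slin sP] := splitP ix.
  apply: (differentials_ext hW (l := fun w => _ (split i w)) (l' := idfun)) => //.
    by move=> a u v /=; rewrite slin linearP.
  move=> a; have [a' <-] := bsurj a; have [/(_ x)[dB _ _] _ _] := hW.
  by rewrite sP linearB !betaP ideal_iso_pb // (zmod_morphism0 dB) subr0.
- by move=> *; exact: split_coc.
Qed.

(** Any other [tau'] is [tau] composed with a nonzero constant [c], and [c] times its cocycle [z']
    is cohomologous to [z], whatever the splittings; so the spans coincide. *)
Lemma double_curve_point_retraction : [set: C] !=set0 ->
  (forall f : forall x, stalk C x, (forall x, reg f x) ->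
     exists c, forall x, f x = cst x c) ->
  forall q, double_curve_point dE dW q <-> q = span1 (cocl z).
Proof.
move=> C0 const q; split; last first.
  have [beta' [betaP ext]] := retraction_extension_cocycle.
  by move=> ->; exists tau, beta', z.
case=> tau' [beta' [z' [htau' betaP [sigma [slin sreg sK sE]] ->]]].
have [c c0 tauE] := ideal_iso_ratio bsurj C0 const htau htau'.
have cz : c *: cocl z' = cocl z.
  rewrite -[LHS]/(H1_scale c (cocl z')) cocl_scale; apply/coclP.
  have dWder x : derivation_along (f := idmor C) (dW (x := x)) by case: hW.
  (* By [decomp], [theta (retr l (sigma j (dW a)))] is the difference of the splittings [sigma j]
     and [split l] at [dW a]. The sign comes from the order of the indices in
     [extension_cocycle]. *)
  exists (idx z' * idx z)%type, (fun m => cov m.1 `&` cov m.2), fst, snd,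
    (fun m x a => - (retr m.2 (sigma m.1 x (dW a)))); split.
  - by move=> m; split=> [|x //]; apply: openI; apply: cov_open.
  - move=> x; have [j jx] := cov_full _ _ z' x; have [l lx] := cov_full _ _ z x.
    by exists (j, l).
  - move=> [j l]; apply: derivation_onN; split=> /=.
    + move=> x [jx lx] a a'; have [dB _ _] := dWder x.
      by rewrite dB (GRing.zmod_morphism_linear (slin j x jx)) (GRing.zmod_morphism_linear (retrP lx).1).
    + move=> x a a' [jx lx]; have [_ _ dM] := dWder x.
      rewrite dM (slin j x jx) (GRing.scalable_linear (slin j x jx)) (retrP lx).1.
      by rewrite (GRing.scalable_linear (retrP lx).1).
    + move=> x c' [jx lx]; have [_ d0 _] := dWder x.
      rewrite d0 (zmod_morphism0 (GRing.zmod_morphism_linear (slin j x jx))).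
      exact: (zmod_morphism0 (GRing.zmod_morphism_linear (retrP lx).1)).
    + move=> s x [jx lx] sx; apply: retr_reg => //; apply: sreg => //.
      exact: (mreg_d hW sx).
  - move=> [j l] [j' l'] x a [/= jx lx] [/= jx' lx'].
    have e1 := decomp lx (betaP x) (sigma j x (dW a)).
    have e2 := decomp lx' (betaP x) (sigma j' x (dW a)).
    rewrite !sK // in e1 e2; apply: theta_inj.
    rewrite opprK thetaB [RHS](zmod_morphismD (@thetaB x)) (zmod_morphismN (@thetaB x)).
    rewrite -[theta (cst x c * _)]/(dE (tau (cst x c * _))) -tauE -sE // -split_coc //.
    set r' := retr l' _ in e2 *; set r := retr l _ in e1 *.
    rewrite e2 e1 !opprD opprK addrACA [split l' _ + _]addrC addrK.
    by rewrite addrAC addNr add0r addrC.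
apply/seteqP; split=> _ [d ->]; rewrite -cz.
  by exists (d / c); rewrite scalerA divfK.
by exists (d * c); rewrite scalerA.
Qed.
End Retractions.

(** * The retractions defined by the trivializations *)

Section Truncated.
Variables (A : comNzRingType) (p : nat).
Local Notation T := (quot ('X^(p.+1) : {poly A})).
Local Notation t := (cl ('X^(p.+1) : {poly A}) 'X).

(** With the next lemmas, this shows that the ideal of [t ^ p] is a copy of [A]: multiplication by
    [t ^ p] sees exactly the constant coefficient. *)
Lemma trunc_top (u : T) : t ^+ p * (u * t) = 0.
Proof.
rewrite mulrCA -exprSr -rmorphXn /=.
suff -> : cl 'X^(p.+1) 'X^(p.+1) = 0 :> T by rewrite mulr0.
by rewrite -[RHS](rmorph0 (cl _)); apply/QuotRing.clP; exists 1; rewrite subr0 mul1r.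
Qed.

Lemma trunc_top_coef (q : {poly A}) : t ^+ p * cl _ q = t ^+ p * cl _ (q`_0)%:P.
Proof.
apply/eqP; rewrite -subr_eq0 -mulrBr -rmorphB /=.
have /factor_theorem[r ->] : root (q - (q`_0)%:P) 0.
  by rewrite /root hornerD hornerN hornerC horner_coef0 subrr.
by rewrite subr0 rmorphM trunc_top.
Qed.

Lemma trunc_coef (q r : {poly A}) i : (i <= p)%N ->
  cl 'X^(p.+1) q = cl 'X^(p.+1) r -> q`_i = r`_i.
Proof.
move=> ip /QuotRing.clP[u e]; apply/eqP; rewrite -subr_eq0 -coefB e.
by rewrite coefMXn ltnS ip.
Qed.

Lemma trunc_top_inj (c c' : A) :
  t ^+ p * cl _ c%:P = t ^+ p * cl _ c'%:P -> c = c'.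
Proof.
rewrite -rmorphXn -!rmorphM => /(trunc_coef (leqnn p)).
by rewrite !coefXnM ltnn subnn !coefC.
Qed.
End Truncated.

Lemma quot_ex (A : comPzRingType) (a : A) (q : quot a) : exists u, cl a u = q.
Proof. by exists (repr q); rewrite /QuotRing.cl reprK. Qed.

Section Pull.
Variables (k : fieldType) (X Y : scheme k) (f : mor X Y) (x : X) (y : Y).
Variable e : f x = y.

Lemma pull_rmorph : rmorph (pull e).
Proof.
by case: y / e; split=> [u v|]; [exact: rmorphB|split=> [|u v]; [exact: rmorph1|exact: rmorphM]].
Qed.

Lemma pull_section s : pull e (s y) = pbf f s x.
Proof. by case: y / e. Qed.

Lemma pull_cst c : pull e (cst y c) = cst x c.
Proof. by case: y / e; exact: pb_cst. Qed.
End Pull.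

(** Equal composite morphisms have equal stalk maps, up to the transport between stalks that [pull]
    absorbs. *)
Lemma pb_pull (k : fieldType) (C X1 Y X : scheme k) (j : mor C X1) (i : mor X1 X)
    (b : mor C Y) (e : mor Y X) x (e1 : i (j x) = e (b x)) a :
  Defs.comp i j = Defs.comp e b -> pb j x (pull e1 a) = pb b x (pb e (b x) a).
Proof.
move=> ij; have gen (m m' : mor C X) (h : m x = m' x) (h' : m' x = m' x) a' :
    m = m' -> pull h a' = pull h' a'.
  by move=> mm'; subst m'; rewrite (Prop_irrelevance h h').
have := gen _ _ (e1 : Defs.comp i j x = Defs.comp e b x) erefl a ij.
rewrite /= => <-; move: e1 a; rewrite -[e (b x)]/(mfun (Defs.comp e b) x).
by case: _ /.
Qed.

Section FragmentedDeformation.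
Variables (k : fieldType) (X C Y X1 X2 : scheme k).
Variables (b : mor C Y) (e : mor Y X) (i1 : mor X1 X) (i2 : mor X2 X).
Variables (j1 : mor C X1) (j2 : mor C X2) (pi : forall x, stalk X x).
Hypothesis pireg : forall x, reg pi x.
Hypothesis bsurj : forall x (u : stalk C x), exists a, pb b x a = u.
Hypothesis esurj : forall y (u : stalk Y y), exists a, pb e y a = u.
Hypothesis eker : forall y a, pb e y a = 0 <-> exists u, a = u * pi (e y).
Hypothesis ij1 : Defs.comp i1 j1 = Defs.comp e b.
Hypothesis ij2 : Defs.comp i2 j2 = Defs.comp e b.
Let pi1 := pbf i1 pi.
Let pi2 := pbf i2 pi.
Variable p : nat.
Hypothesis pspec : spectrum_exponent i1 i2 j1 j2 pi p.
Variable Phi : forall x, quot (pi1 (j1 x) ^+ p) -> quot (pi2 (j2 x) ^+ p).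
Hypothesis hPhi : gluing_iso (i1 := i1) (i2 := i2) (pi := pi) Phi.
Variable z : cocycle C.
Variables (phi1 : idx z -> forall x, nbhd_stalk j1 pi1 p.+1 x -> trunc_stalk p.+1 x)
  (psi1 : idx z -> forall x, trunc_stalk p.+1 x -> nbhd_stalk j1 pi1 p.+1 x)
  (phi2 : idx z -> forall x, nbhd_stalk j2 pi2 p.+1 x -> trunc_stalk p.+1 x)
  (psi2 : idx z -> forall x, trunc_stalk p.+1 x -> nbhd_stalk j2 pi2 p.+1 x).
Hypothesis triv1 : forall i, trivialization (cov i) (phi1 i) (psi1 i).
Hypothesis triv2 : forall i, trivialization (cov i) (phi2 i) (psi2 i).
Hypothesis phi12 : forall i x a1 a2, cov i x -> @Phi x (cl _ a1) = cl _ a2 ->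
  exists u, @phi2 i x (cl _ a2) - @phi1 i x (cl _ a1) = cl _ 'X ^+ p * u.
Hypothesis phi_coc : forall i j x (a : stalk C x), cov i x -> cov j x ->
  (@phi2 i x) (@psi2 j x (cl _ a%:P)) - (@phi1 i x) (@psi1 j x (cl _ a%:P)) =
  cl _ 'X ^+ p * cl _ (coc i j x a)%:P.

Let eq1 x : i1 (j1 x) = e (b x) := congr1 (fun m : mor C X => mfun m x) ij1.
Let eq2 x : i2 (j2 x) = e (b x) := congr1 (fun m : mor C X => mfun m x) ij2.

Let p1 x := pull (eq1 x).
Let p2 x := pull (eq2 x).

Let p1M x : rmorph (p1 (x := x)). Proof. exact: pull_rmorph. Qed.
Let p2M x : rmorph (p2 (x := x)). Proof. exact: pull_rmorph. Qed.

Let p1_pi x : p1 (pi (e (b x))) = pi1 (j1 x). Proof. exact: pull_section. Qed.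
Let p2_pi x : p2 (pi (e (b x))) = pi2 (j2 x). Proof. exact: pull_section. Qed.

Let pb1 x a : pb j1 x (p1 a) = pb b x (pb e (b x) a). Proof. exact: pb_pull. Qed.
Let pb2 x a : pb j2 x (p2 a) = pb b x (pb e (b x) a). Proof. exact: pb_pull. Qed.

Let pb_pi y : pb e y (pi (e y)) = 0.
Proof. by apply/eker; exists 1; rewrite mul1r. Qed.

(* [diff i a] is divisible by [t ^ p]; the quotient [retraction i] is defined on
   [O_Y] because [diff i] vanishes at [pi]. *)
Let diff i x (a : stalk X (e (b x))) : trunc_stalk p.+1 x :=
  @phi2 i x (cl _ (p2 a)) - @phi1 i x (cl _ (p1 a)).

Let X_ (x : C) : trunc_stalk p.+1 x := cl _ 'X.

Let diffB i x : cov i x -> zmod_morphism (@diff i x).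
Proof.
move=> ix a a'; rewrite /diff (p1M x).1 (p2M x).1 !rmorphB.
by rewrite (triv_rmorph (triv1 i) ix).1 (triv_rmorph (triv2 i) ix).1 !opprD !opprK addrACA.
Qed.

(** Germs of [X] are pairs matched by [Phi], through which the trivializations agree modulo
    [t ^ p]. *)
Let diff_ex i x a : cov i x -> exists c : stalk C x, diff i a = X_ x ^+ p * cl _ c%:P.
Proof.
move=> ix; have [u uE] : exists u, diff i a = X_ x ^+ p * u.
  by apply: phi12 => //; apply/(glue_image hPhi (eq1 x) (eq2 x)); exists a.
by have [q qu] := quot_ex u; exists q`_0; rewrite uE -qu trunc_top_coef.
Qed.

(* The constant coefficient of [phi] is the restriction to [C]. *)
Let phi1_top i x a : cov i x ->
  X_ x ^+ p * @phi1 i x (cl _ a) = X_ x ^+ p * cl _ (pb j1 x a)%:P.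
Proof.
move=> ix; have [u uE] := triv_id (triv1 i) a ix.
by apply/eqP; rewrite -subr_eq0 -mulrBr uE trunc_top.
Qed.

Let phi2_top i x a : cov i x ->
  X_ x ^+ p * @phi2 i x (cl _ a) = X_ x ^+ p * cl _ (pb j2 x a)%:P.
Proof.
move=> ix; have [u uE] := triv_id (triv2 i) a ix.
by apply/eqP; rewrite -subr_eq0 -mulrBr uE trunc_top.
Qed.

(** As [diff] is divisible by [t ^ p], the two factors act only through the restrictions of [a] and
    [a'] to [C]; this becomes a Leibniz rule. *)
Let diffM i x a a' : cov i x -> diff i (a * a') =
  @phi2 i x (cl _ (p2 a)) * diff i a' + @phi1 i x (cl _ (p1 a')) * diff i a.
Proof.
move=> ix; have [_ [_ M1]] := triv_rmorph (triv1 i) ix.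
have [_ [_ M2]] := triv_rmorph (triv2 i) ix.
rewrite /diff (p1M x).2.2 (p2M x).2.2 !rmorphM M1 M2 !mulrBr.
by rewrite [phi1 _ _ * phi2 _ _]mulrC addrA subrK [phi1 _ _ * phi1 _ _]mulrC.
Qed.

Let diff_pi i x : cov i x -> diff i (pi (e (b x))) = 0.
Proof.
by move=> ix; rewrite /diff p1_pi p2_pi (triv_t (triv1 i) ix) (triv_t (triv2 i) ix) subrr.
Qed.

(** The kernel is generated by [pi], and [diff i (u * pi)] is [t * diff i u], a multiple of
    [t ^ p.+1]. *)
Let diff_wd i x (a a' : stalk X (e (b x))) : cov i x ->
  pb e (b x) a = pb e (b x) a' -> diff i a = diff i a'.
Proof.
move=> ix aa'; have /eker[u uE] : pb e (b x) (a - a') = 0.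
  by rewrite rmorphB aa' subrr.
apply/eqP; rewrite -subr_eq0 -diffB // uE diffM // diff_pi // mulr0 add0r.
rewrite p1_pi (triv_t (triv1 i) ix).
by have [c ->] := diff_ex u ix; rewrite mulrCA [X in _ * X]mulrC trunc_top.
Qed.

Let D_ex i x (a : stalk Y (b x)) : exists c : stalk C x, cov i x ->
  forall a', pb e (b x) a' = a -> diff i a' = X_ x ^+ p * cl _ c%:P.
Proof.
have [ix|ix] := pselect (cov i x); last by exists 0.
have [a0 a0E] := esurj a; have [c cE] := diff_ex a0 ix.
by exists c => _ a' a'E; rewrite -cE; apply: diff_wd; rewrite ?a0E.
Qed.

Definition retraction i x (a : stalk Y (b x)) : (stalk C x)^o :=
  projT1 (cid (D_ex i a)).

Let DE i x a : cov i x ->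
  diff i a = X_ x ^+ p * cl _ (retraction i (pb e (b x) a))%:P.
Proof. by move=> ix; apply: (projT2 (cid (D_ex i (pb e (b x) a))) ix). Qed.

Let D_uniq i x a (c : stalk C x) : cov i x ->
  diff i a = X_ x ^+ p * cl _ c%:P -> retraction i (pb e (b x) a) = c.
Proof. by move=> ix; rewrite DE // => /trunc_top_inj. Qed.

Lemma retraction_derivation i x : cov i x ->
  derivation_along (@retraction i x).
Proof.
move=> ix; split.
- move=> a a'; have [u <-] := esurj a; have [v <-] := esurj a'.
  rewrite -rmorphB; apply: D_uniq => //.
  by rewrite diffB // !DE // -mulrBr -!rmorphB.
- move=> c; rewrite -[cst (b x) c](pb_cst e); apply: D_uniq => //.
  rewrite /diff /p1 /p2 !pull_cst (triv_cst (triv1 i)) // (triv_cst (triv2 i)) //.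
  by rewrite subrr !rmorph0 mulr0.
- move=> a a'; have [u <-] := esurj a; have [v <-] := esurj a'.
  rewrite -rmorphM; apply: D_uniq => //.
  rewrite diffM // !DE // !mulrA ![_ * X_ x ^+ p]mulrC phi1_top // phi2_top //.
  by rewrite pb1 pb2 -!mulrA -mulrDr -!rmorphM -!rmorphD.
Qed.

(** Near [x] the value is a difference of coefficients of [t ^ p] in polynomials with regular
    coefficients, which represent the images of a local lift to [X]. *)
Lemma retraction_reg i t x : cov i x -> reg t (b x) ->
  reg (fun y => retraction i (t (b y))) x.
Proof.
move=> ix tx; have [s sx st] := lift_near (esurj (t (b x))) tx.
have stb : \forall y \near x, pb e (b y) (s (e (b y))) = t (b y) := mor_cont st.
have iN : \forall y \near x, cov i y.
  by apply: open_nbhs_nbhs; split=> //; exact: cov_open.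
have s1x : reg (pbf i1 s) (j1 x) by apply: pb_reg; rewrite eq1.
have s2x : reg (pbf i2 s) (j2 x) by apply: pb_reg; rewrite eq2.
have [|c1 c1x phi1E] := triv_reg (triv1 i) (q := fun y => cl _ (pbf i1 s (j1 y))) ix.
  by exists (pbf i1 s) => //; exact: nearW.
have [|c2 c2x phi2E] := triv_reg (triv2 i) (q := fun y => cl _ (pbf i2 s (j2 y))) ix.
  by exists (pbf i2 s) => //; exact: nearW.
apply: (reg_germ _ (regB (c2x p) (c1x p))).
near=> y; have iy : cov i y by near: y.
rewrite -(near stb y) //; have := DE (s (e (b y))) iy.
rewrite /diff /p1 /p2 !pull_section (near phi1E y) // (near phi2E y) //.
rewrite /X_ -rmorphXn -rmorphM -rmorphB /= => /(trunc_coef (leqnn p)).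
by rewrite coefB !coef_poly ltnSn coefXnM ltnn subnn coefC.
Unshelve. all: by end_near.
Qed.

(** * The generator of the ideal of [C] in [Y] *)

Let xi_ex x : exists a : stalk X (e (b x)), [/\ p1 a = pi1 (j1 x) ^+ p, p2 a = 0 &
  forall a', pb b x (pb e (b x) a') = 0 <-> exists u v, a' = u * a + v * pi (e (b x))].
Proof.
have [a [a1 a2 aP]] := pspec.2 x _ (eq1 x) (eq2 x); exists a; split=> // a'.
by rewrite -pb1; exact: aP.
Qed.

Let xi x := projT1 (cid (xi_ex x)).
Let p1_xi x : p1 (xi x) = pi1 (j1 x) ^+ p.
Proof. by have [] := projT2 (cid (xi_ex x)). Qed.
Let p2_xi x : p2 (xi x) = 0.
Proof. by have [] := projT2 (cid (xi_ex x)). Qed.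
Let xiP x a : pb b x (pb e (b x) a) = 0 <->
  exists u v, a = u * xi x + v * pi (e (b x)).
Proof. by have [] := projT2 (cid (xi_ex x)). Qed.

(** Both sides have components [(pi1 ^ (p + p), 0)]. Since [pi] vanishes on [Y] and [p > 0], the
    image of [xi] in [Y] has square zero. *)
Let xi_sq x : xi x * xi x = pi (e (b x)) ^+ p * xi x.
Proof.
apply/eqP; rewrite -subr_eq0; apply/eqP.
apply: (glue_inj hPhi (x := x) (e1 := eq1 x) (e2 := eq2 x)).
  rewrite -[LHS]/(p1 _) (p1M x).1 !(p1M x).2.2 (rmorph_exp _ _ (p1M x)) p1_pi p1_xi.
  by rewrite subrr.
by rewrite -[LHS]/(p2 _) (p2M x).1 !(p2M x).2.2 p2_xi !mulr0 subrr.
Qed.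

Let p_gt0 : (0 < p)%N. Proof. by have [] := pspec. Qed.

Let eta x : stalk Y (b x) := pb e (b x) (xi x).

(** The ideal of [C] in [X] is generated by [xi] and [pi], whose products with [xi] are multiples of
    [pi]. Hence [a * eta] depends only on the restriction of [a] to [C]. *)
Let eta0 x a : pb b x a = 0 -> a * eta x = 0.
Proof.
have [a' <-] := esurj a => /xiP[u [v ->]].
rewrite /eta -rmorphM mulrDl -mulrA xi_sq.
rewrite !(rmorphD, rmorphM, rmorphXn) /= pb_pi expr0n -leqn0 leqNgt p_gt0.
by rewrite mul0r mulr0 mulr0 mul0r addr0.
Qed.

Let pb_eta x : pb b x (eta x) = 0.
Proof. by apply/xiP; exists 1, 0; rewrite mul1r mul0r addr0. Qed.

(* The sign makes [retraction i] a left inverse. *)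
Definition ideal_gen_map x (u : stalk C x) : stalk Y (b x) :=
  - projT1 (cid (bsurj u)) * eta x.

Let tauE x a : ideal_gen_map (pb b x a) = - a * eta x.
Proof.
rewrite /ideal_gen_map; apply/eqP; rewrite -subr_eq0 -mulrBl; apply/eqP/eta0.
rewrite rmorphB !rmorphN (projT2 (cid (bsurj (pb b x a)))) subrr.
by [].
Qed.

(** The lift [- a' * xi] has second component [0], and the opposite of its first one is sent by the
    trivialization to [t ^ p] times the restriction of [a']. *)
Lemma retraction_ideal_gen i x u : cov i x ->
  retraction i (ideal_gen_map u) = u :> stalk C x.
Proof.
move=> ix; have [a <-] := bsurj u; have [a' <-] := esurj a.
rewrite tauE -rmorphN -rmorphM; apply: D_uniq => //.
rewrite /diff (p1M x).2.2 (p2M x).2.2 p2_xi p1_xi mulr0.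
have [r1 r2] := (triv_rmorph (triv1 i) ix, triv_rmorph (triv2 i) ix).
rewrite rmorph0 (zmod_morphism0 r2.1) sub0r rmorphM r1.2.2 rmorphXn (rmorph_exp _ _ r1).
rewrite (triv_t (triv1 i) ix) mulrC phi1_top // pb1 !rmorphN /= mulrN opprK.
by [].
Qed.

Lemma ideal_gen_iso : ideal_iso ideal_gen_map.
Proof.
split.
- move=> x u v; have [a <-] := bsurj u; have [a' <-] := bsurj v.
  by rewrite -rmorphB !tauE -mulrBl opprB opprK addrC.
- move=> x a u; have [a' <-] := bsurj u.
  by rewrite -rmorphM !tauE !mulNr mulrN mulrA.
(* Injectivity comes from the left inverse [retraction i]. *)
- move=> x u v uv; have [i ix] := cov_full _ _ z x.
  by rewrite -(retraction_ideal_gen u ix) uv retraction_ideal_gen.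
- move=> x a; have [a' <-] := esurj a; split.
    move=> /xiP[u [v ->]]; exists (pb b x (pb e (b x) (- u))).
    by rewrite tauE rmorphD !rmorphM pb_pi mulr0 addr0 rmorphN opprK.
  move=> [u uE]; have [a'' a''E] := bsurj u.
  by rewrite -uE -a''E tauE rmorphM pb_eta mulr0.
- move=> s x sx; have [t tx ts] := lift_near (bsurj (s x)) sx.
  (* [xi] was chosen point by point. A section [q] with germ [xi x] has components [(pi1 ^ p, 0)]
     near [x], so it agrees there with [xi] along [C]. *)
  have [q qx qxi] := reg_ex (xi x).
  have q1 : \forall w \near j1 x, pbf i1 q w = pi1 w ^+ p.
    apply: reg_near; first by apply: pb_reg; rewrite eq1.
      by apply: reg_exp; apply: pb_reg.
    by rewrite -(pull_section (eq1 x)) qxi; exact: p1_xi.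
  have q2 : \forall w \near j2 x, pbf i2 q w = 0.
    apply: (reg_near (s' := fun=> 0)); first by apply: pb_reg; rewrite eq2.
      by apply: (eq_reg _ (reg_cst 0 _)) => y; rewrite rmorph0.
    by rewrite -(pull_section (eq2 x)) qxi; exact: p2_xi.
  have {}q1 : \forall y \near x, pbf i1 q (j1 y) = pi1 (j1 y) ^+ p := mor_cont q1.
  have {}q2 : \forall y \near x, pbf i2 q (j2 y) = 0 := mor_cont q2.
  exists (fun w => - t w * pb e w (q (e w))).
    by apply: regM; [exact: regN|exact: pb_reg].
  near=> y; rewrite -(near ts y) // tauE; congr (_ * pb e _ _).
  apply/eqP; rewrite -subr_eq0; apply/eqP.
  apply: (glue_inj hPhi (x := y) (e1 := eq1 y) (e2 := eq2 y)).
    rewrite -[LHS]/(p1 _) (p1M y).1 p1_xi.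
    by rewrite [p1 (q _)]pull_section (near q1 y) // subrr.
  rewrite -[LHS]/(p2 _) (p2M y).1 p2_xi.
  by rewrite [p2 (q _)]pull_section (near q2 y) // subrr.
Unshelve. all: by end_near.
Qed.

(** Let [h1], [h2] be the transition maps from [j] to [i] and [q] represent [phi1 j (p1 a')]. Then
    [diff i a' = h2 (q + diff j a') - h1 q], where [h2] fixes [diff j a']. The remaining
    [h2 q - h1 q] is [t ^ p] times the cocycle at the constant coefficient of [q], the restriction
    of [a'] to [C]. *)
Lemma retraction_coc i j x a : cov i x -> cov j x ->
  retraction i a - retraction j a = coc i j x (pb b x a).
Proof.
move=> ix jx; have [a' <-] := esurj a.
set d := retraction i _ - _.
rewrite -[RHS](_ : d = _) //; apply: (@trunc_top_inj _ p); rewrite -/(X_ x).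
have g1 := rmorph_inverse (triv_K (triv1 j) jx) (triv_VK (triv1 j) jx) (triv_rmorph (triv1 j) jx).
have g2 := rmorph_inverse (triv_K (triv2 j) jx) (triv_VK (triv2 j) jx) (triv_rmorph (triv2 j) jx).
have r1 := triv_rmorph (triv1 i) ix.
have r2 := triv_rmorph (triv2 i) ix.
pose h1 u := @phi1 i x (@psi1 j x u); pose h2 u := @phi2 i x (@psi2 j x u).
have h1M : rmorph h1.
  by split=> [u v|]; rewrite /h1 ?g1.1 ?r1.1 //; split=> [|u v]; rewrite ?g1.2.1 ?r1.2.1 // g1.2.2 r1.2.2.
have h2M : rmorph h2.
  by split=> [u v|]; rewrite /h2 ?g2.1 ?r2.1 //; split=> [|u v]; rewrite ?g2.2.1 ?r2.2.1 // g2.2.2 r2.2.2.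
have h1X : h1 (X_ x) = X_ x.
  by rewrite /h1 /X_ -{1}(triv_t (triv1 j) jx) (triv_K (triv1 j) jx) (triv_t (triv1 i) ix).
have h2X : h2 (X_ x) = X_ x.
  by rewrite /h2 /X_ -{1}(triv_t (triv2 j) jx) (triv_K (triv2 j) jx) (triv_t (triv2 i) ix).
have h2_top c : X_ x ^+ p * h2 (cl _ c%:P) = X_ x ^+ p * cl _ c%:P.
  rewrite /h2; have [v vE] := quot_ex (psi2 j (cl _ c%:P)).
  rewrite -vE phi2_top // -(phi2_top _ jx) vE (triv_VK (triv2 j) jx).
  by [].
(* Both maps fix [t] and differ on constants by multiples of [t ^ p], so they agree on multiples of
   [t]. *)
have h12 q : h2 (cl _ q) - h1 (cl _ q) = X_ x ^+ p * cl _ (coc i j x q`_0)%:P.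
  elim/poly_ind: q => [|q c IH].
    rewrite !rmorph0 (zmod_morphism0 h1M.1) (zmod_morphism0 h2M.1) coef0.
    rewrite (zmod_morphism0 (der_add (coc_der i j) _)) //.
    by rewrite !rmorph0 subrr mulr0.
  rewrite !rmorphD !rmorphM !(zmod_morphismD h1M.1) !(zmod_morphismD h2M.1) h1M.2.2 h2M.2.2.
  rewrite -/(X_ x) h1X h2X opprD addrACA -mulrBl IH -mulrA trunc_top add0r.
  by rewrite /h1 /h2 phi_coc // coefD coefMX coefC add0r.
have [q qE] := quot_ex (phi1 j (cl _ (p1 a'))).
have q0 : q`_0 = pb b x (pb e (b x) a').
  by apply: (@trunc_top_inj _ p); rewrite -trunc_top_coef qE phi1_top // pb1.
have diffE : diff i a' = X_ x ^+ p * cl _ (coc i j x q`_0)%:P + diff j a'.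
  have phi2E : @phi2 j x (cl _ (p2 a')) = cl _ q + diff j a'.
    by rewrite qE /diff addrC subrK.
  have -> : diff i a' = h2 (phi2 j (cl _ (p2 a'))) - h1 (cl _ q).
    by rewrite qE /h1 /h2 (triv_K (triv1 j) jx) (triv_K (triv2 j) jx).
  rewrite phi2E (zmod_morphismD h2M.1) addrAC h12 DE // h2M.2.2 (rmorph_exp _ _ h2M).
  by rewrite h2X h2_top.
by rewrite /d !rmorphB mulrBr -!DE // diffE addrK q0.
Qed.

Lemma double_curve_point_lambda
    (E : omodule C) (dE : forall x, stalk Y (b x) -> mstalk E x)
    (W : omodule C) (dW : forall x, stalk C x -> mstalk W x) :
  is_differentials dE -> is_differentials (f := idmor C) dW -> [set: C] !=set0 ->
  (forall f : forall x, stalk C x, (forall x, reg f x) ->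
     exists c, forall x, f x = cst x c) ->
  forall q, double_curve_point dE dW q <-> q = span1 (cocl z).
Proof.
move=> hE hW.
exact: (double_curve_point_retraction bsurj hE hW ideal_gen_iso
  retraction_derivation retraction_ideal_gen retraction_reg retraction_coc).
Qed.

End FragmentedDeformation.

Theorem theorem6p0p1 (R : realType)
  (S X C Y X1 X2 : scheme (complex R))
  (t : forall s : S, stalk S s) (f : mor X S)
  (b : mor C Y) (e : mor Y X)
  (i1 : mor X1 X) (i2 : mor X2 X) (j1 : mor C X1) (j2 : mor C X2)
  (hdef : fragmented_deformation t f b e i1 i2 j1 j2)
  (p : nat)
  (hspec : has_spectrum i1 i2 j1 j2 (pbf f t)
     (\matrix_(i < 2, j < 2) (if i == j then 0%N else p)))
  (Phi : forall x : C, quot (pbf i1 (pbf f t) (j1 x) ^+ p) ->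
                       quot (pbf i2 (pbf f t) (j2 x) ^+ p))
  (hPhi : gluing_iso Phi)
  (w : H1T C)
  (hw : lambda_inv (j1 := j1) (j2 := j2) (pi1 := pbf i1 (pbf f t))
          (pi2 := pbf i2 (pbf f t)) (p := p) Phi w)
  (E : omodule C) (dE : forall x : C, stalk Y (b x) -> mstalk E x)
  (hE : is_differentials (f := b) dE)
  (W : omodule C) (dW : forall x : C, stalk C x -> mstalk W x)
  (hW : is_differentials (f := idmor C) dW) :
  forall q : set (H1T C), double_curve_point dE dW q <-> q = span1 w.
Proof.
have [Chyp bred _ _] := let: conj h _ := frag_double hdef in h.
have [bimm _ Cred] := bred; have [_ C0 Cconn Cproj] := Chyp.
have [g [A [iota [rho [_ _ rhoP _ tE]]]]] := frag_base hdef.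
have treg s : reg t s.
  by apply: (eq_reg _ (spec_reg rhoP (iota 'X) (I : setT s))) => s'; rewrite tE.
have pireg x : reg (pbf f t) x by apply: pb_reg.
have bsurj : forall x (u : stalk C x), exists a, pb b x a = u by case: bimm.
have [[_ _ _ esurj] _ eker0] := frag_fibre0 hdef.
have eker y a : pb e y a = 0 <-> exists u, a = u * pbf f t (e y).
  by rewrite eker0 rmorph0 subr0.
have pspec : spectrum_exponent i1 i2 j1 j2 (pbf f t) p.
  (* An off-diagonal entry identifies the exponent [p'] given by the spectrum with [p]. *)
  have [p' hp' /matrixP/(_ ord0 ord_max)] := hspec.
  by rewrite !mxE /= => ->.
have [z [phi1 [psi1 [phi2 [psi2 [_ triv1 triv2 phi12 phi_coc]]]]] ->] := hw.
have const (h : forall x, stalk C x) := global_section_constant (f := h) Cred C0 Cconn Cproj.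
exact: (double_curve_point_lambda pireg bsurj esurj eker (frag_ij1 hdef)
  (frag_ij2 hdef) pspec hPhi triv1 triv2 phi12 phi_coc hE hW C0 const).
Qed.
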